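(* Let $d\ge 2$ be an integer. For all positive integers $N$ and all $N$-point sets $\mathcal{P} \subset [0,1)^d$, the discrepancy function $D_{\mathcal{P}}$ of $\mathcal{P}$ satisfies $$ \| D_{\mathcal{P}} \mid L_2 \| \ge c_d\, (\log N)^{\frac{d-1}{2}} \qquad\text{with}\qquad c_d = \frac{7}{27\cdot 2^{2d-1}\,\sqrt{(d-1)!}\,(\log 2)^{\frac{d-1}{2}}} .$$
   Context: $\log$ denotes the natural logarithm. For a finite set $\mathcal{P}\subset[0,1)^d$ with $N$ (distinct) points, the discrepancy function is defined for $x=(x_1,\ldots,x_d)\in[0,1)^d$ by $$ D_{\mathcal{P}}(x) = \sum_{z\in\mathcal{P}} \mathbf{1}_{C_z}(x) - N\,|B_x|, $$ where $|B_x| = x_1\cdots x_d$ is the volume of the box $B_x=[0,x_1)\times\cdots\times[0,x_d)$ and $\mathbf{1}_{C_z}$ is the characteristic function of $C_z=(z_1,1)\times\cdots\times(z_d,1)$ for $z=(z_1,\ldots,z_d)$ (so the sum is the number of points of $\mathcal{P}$ in $B_x$). The $L_2$-discrepancy of $\mathcal{P}$ is $\|D_{\mathcal{P}} \mid L_2\| = \left(\int_{[0,1)^d} D_{\mathcal{P}}(x)^2\,dx\right)^{1/2}$. *)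

(* Defs.v *)
From HB Require Import structures.
From mathcomp Require Import all_boot all_order all_algebra finmap.
From mathcomp Require Import all_classical all_reals all_analysis.

Set Implicit Arguments.
Unset Strict Implicit.
Unset Printing Implicit Defensive.

Import Order.TTheory GRing.Theory Num.Theory.
Import numFieldNormedType.Exports.

Local Open Scope classical_set_scope.
Local Open Scope ring_scope.

Section tuple_lebesgue_measure.
Variable R : realType.
Local Notation T := (measurableTypeR R).

Definition tuple_cons n (p : T * n.-tuple T) : n.+1.-tuple T :=
  [tuple of p.1 :: p.2].

Lemma measurable_tuple_cons n : measurable_fun [set: (T * n.-tuple T)%type] (@tuple_cons n).
Proof. exact: (measurable_cons measurable_fst measurable_snd). Qed.

Section step.
Variables (n : nat) (mu : {sigma_finite_measure set (n.-tuple T) -> \bar R}).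

Definition tuple_lebesgue_step : set (n.+1.-tuple T) -> \bar R :=
  pushforward (@lebesgue_measure R \x mu)%E (@tuple_cons n).

Let step0 : tuple_lebesgue_step set0 = 0%E.
Proof. by rewrite /tuple_lebesgue_step /pushforward preimage_set0 measure0. Qed.

Let step_ge0 A : (0 <= tuple_lebesgue_step A)%E.
Proof. by rewrite /tuple_lebesgue_step /pushforward; exact: measure_ge0. Qed.

Let step_sigma_additive : semi_sigma_additive tuple_lebesgue_step.
Proof.
move=> F mF tF mUF; rewrite /tuple_lebesgue_step /pushforward preimage_bigcup.
have mp A : measurable A -> measurable (@tuple_cons n @^-1` A).
  by move=> mA; rewrite -[X in measurable X]setTI; exact: measurable_tuple_cons.
apply: measure_semi_sigma_additive.
- by move=> k; apply: mp; exact: mF.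
- apply/trivIsetP => /= i j _ _ ij; rewrite -preimage_setI.
  by move/trivIsetP : tF => /(_ _ _ _ _ ij) ->//; rewrite preimage_set0.
- by rewrite -preimage_bigcup; exact: mp.
Qed.

HB.instance Definition _ := isMeasure.Build _ _ _ tuple_lebesgue_step
  step0 step_ge0 step_sigma_additive.

Let step_sigma_finite : sigma_finite setT tuple_lebesgue_step.
Proof.
have /sigma_finiteP[F [FT Fnd Foo]] := sigma_finiteT (@lebesgue_measure R).
have /sigma_finiteP[G [GT Gnd Goo]] := sigma_finiteT mu.
pose tl (x : n.+1.-tuple T) : T * n.-tuple T := (thead x, [tuple of behead x]).
have consK : cancel (@tuple_cons n) tl.
  by move=> [x y]; rewrite /tl /tuple_cons theadE; congr pair; exact: val_inj.
exists (fun k => tl @^-1` (F k `*` G k)).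
  rewrite -preimage_bigcup; apply/esym/seteqP; split => // x _ /=.
  have [i _ Fi] : (\bigcup_i F i) (thead x) by rewrite -FT.
  have [j _ Gj] : (\bigcup_i G i) [tuple of behead x] by rewrite -GT.
  exists (maxn i j) => //; split => /=.
    by move: Fi; exact/subsetPset/Fnd/leq_maxl.
  by move: Gj; exact/subsetPset/Gnd/leq_maxr.
move=> k; have [mF Fk] := Foo k; have [mG Gk] := Goo k; split.
  have mtl : measurable_fun setT tl.
    apply/measurable_fun_pairP; split; first exact: measurable_tnth.
    exact: measurable_behead.
  rewrite -[X in measurable X]setTI; apply: mtl => //.
  exact: measurableX.
rewrite /tuple_lebesgue_step /pushforward -comp_preimage.
rewrite (_ : tl \o _ = id); last by apply/funext => x /=; rewrite consK.
rewrite preimage_id product_measure1E// lte_mul_pinfty// ge0_fin_numE//.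
Qed.

HB.instance Definition _ :=
  Measure_isSigmaFinite.Build _ _ _ tuple_lebesgue_step step_sigma_finite.

End step.

(* Lebesgue measure on R^n (with the product sigma-algebra), obtained by
   transporting lebesgue_measure \x tuple_lebesgue_measure n along the bijection
   R x R^n -> R^(n+1); see tuple_lebesgue_measure_rect for its values on boxes. *)
Fixpoint tuple_lebesgue_measure n :
    {sigma_finite_measure set (n.-tuple T) -> \bar R} :=
  match n with
  | 0 => \d_([tuple] : 0.-tuple T)
  | n'.+1 => tuple_lebesgue_step (tuple_lebesgue_measure n')
  end.

Lemma tuple_lebesgue_measure_rect n (A : 'I_n -> set T) :
  (forall i, measurable (A i)) ->
  tuple_lebesgue_measure n [set x | forall i, A i (tnth x i)] =
  (\prod_(i < n) lebesgue_measure (A i))%E.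
Proof.
elim: n A => [|n IH] A mA.
  rewrite big_ord0 /= diracE mem_set//= => i; by case: i.
rewrite big_ord_recl -IH; last by move=> i; exact: mA.
rewrite -product_measure1E//; last first.
  rewrite (_ : mkset _ = \bigcap_(i in [set: 'I_n])
    ((fun x : n.-tuple T => tnth x i) @^-1` A (lift ord0 i))).
    apply: fin_bigcap_measurable => // i _.
    by rewrite -[X in measurable X]setTI; exact: measurable_tnth.
  by apply/seteqP; split => x Ax i; [move=> _; exact: Ax|exact: (Ax i I)].
rewrite /= /tuple_lebesgue_step /pushforward; congr (_ _).
apply/seteqP; split => -[x y] /=.
  move=> Axy; split=> [|i]; first by have := Axy ord0.
  by have := Axy (lift ord0 i); rewrite tnthS.
move=> [Ax Ay] i; case: (unliftP ord0 i) => [j|] ->//.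
by rewrite tnthS.
Qed.

End tuple_lebesgue_measure.

Section discrepancy.
Variables (R : realType) (d : nat).
Implicit Types (x z : d.-tuple R) (P : {fset d.-tuple R}).

Definition unit_cube : set (d.-tuple R) :=
  [set x | forall i, 0 <= tnth x i < 1].

(* For x and z in the unit cube, x is in upper_box z iff z lies in the box
   [0, x_1) x ... x [0, x_d), whose volume is x_1 ... x_d. *)
Definition upper_box z : set (d.-tuple R) :=
  [set x | forall i, tnth z i < tnth x i < 1].

Definition discrepancy P x : R :=
  \sum_(z <- P) \1_(upper_box z) x - #|` P|%:R * \prod_(i < d) tnth x i.

(* The integrand is bounded and measurable on the cube, so the real-valued
   integral loses nothing over the extended-real one. *)
Definition L2_discrepancy P : R :=
  Num.sqrt (\int[tuple_lebesgue_measure R d]_(x in unit_cube)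
    discrepancy P x ^+ 2).

Definition discrepancy_const : R :=
  7 / (27 * 2 ^+ (2 * d - 1) * Num.sqrt ((d - 1)`!%:R)
       * (ln 2) `^ ((d - 1)%:R / 2)).

End discrepancy.

(* Main.v *)
(* Roth's method with Haar functions, as Bessel's inequality: a Haar function
   supported on a box that contains no point of P is orthogonal to the counting
   part of the discrepancy, so its coefficient is that of N x_1 ... x_d.  For
   boxes of volume v this yields, per level and up to the factor 16^-d, the
   amount (N v)^2 (1 - N v).  With N v = t, t/2, t/4, ... and t in [1/2, 1) the
   sum is 4/3 t^2 - 8/7 t^3, whose maximum 196/729 at t = 7/9 gives the constant.
   With dyadic boxes t is dictated by N.  To reach t = 7/9 for every N, the grids
   of the first coordinate have steps c 2^-i, where 2^M c^-1 = 9/7 N and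
   1/2 <= c <= 1; they do not fill [0, 1) exactly.  What is lost on the uncovered
   part is regained from the functions that are constant in the first coordinate
   and Haar in the others, which a Haar basis with mean-zero factors leaves out. *)
Require Import Defs.
From HB Require Import structures.
From mathcomp Require Import all_boot all_order all_algebra finmap.
From mathcomp Require Import all_classical all_reals all_analysis.
From mathcomp Require Import measurable_realfun ring lra zify.

Set Implicit Arguments.
Unset Strict Implicit.
Unset Printing Implicit Defensive.

Import Order.TTheory GRing.Theory Num.Theory.
Import numFieldNormedType.Exports.

Local Open Scope classical_set_scope.
Local Open Scope ring_scope.

(** * Integrals of products of one-variable functions *)

Lemma integrable_prod_tensor d1 d2 (T1 : measurableType d1)
    (T2 : measurableType d2) (R : realType)
    (m1 : {sigma_finite_measure set T1 -> \bar R})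
    (m2 : {sigma_finite_measure set T2 -> \bar R}) (f : T1 -> R) (g : T2 -> R) :
  m1.-integrable setT (EFin \o f) -> m2.-integrable setT (EFin \o g) ->
  (m1 \x m2)%E.-integrable setT (EFin \o (fun z => f z.1 * g z.2)).
Proof.
move=> intf intg.
have mf : measurable_fun setT f by exact/measurable_EFinP/(measurable_int m1).
have mg : measurable_fun setT g by exact/measurable_EFinP/(measurable_int m2).
apply/integrable12ltyP.
  apply/measurable_EFinP/measurable_funM.
    exact: (measurableT_comp mf measurable_fst).
  exact: (measurableT_comp mg measurable_snd).
under eq_integral => x _.
  under eq_integral => y _ do rewrite /= normrM EFinM.
  rewrite ge0_integralZl//; last exact/measurable_EFinP/measurableT_comp.
  over.
have /integrableP[_ fy] := intf; have /integrableP[_ gy] := intg.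
rewrite ge0_integralZr//; last 2 first.
- exact/measurable_EFinP/measurableT_comp.
- exact: integral_ge0.
by apply: lte_mul_pinfty => //;
  [exact: integral_ge0|rewrite ge0_fin_numE//; exact: integral_ge0].
Qed.

Lemma Rintegral_prod_tensor d1 d2 (T1 : measurableType d1)
    (T2 : measurableType d2) (R : realType)
    (m1 : {sigma_finite_measure set T1 -> \bar R})
    (m2 : {sigma_finite_measure set T2 -> \bar R}) (f : T1 -> R) (g : T2 -> R) :
  m1.-integrable setT (EFin \o f) -> m2.-integrable setT (EFin \o g) ->
  \int[(m1 \x m2)%E]_z (f z.1 * g z.2) = \int[m1]_x f x * \int[m2]_x g x.
Proof.
move=> intf intg; rewrite {1}/Rintegral.
have := integral12_prod_meas1 (integrable_prod_tensor intf intg).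
rewrite /comp => <-; rewrite /fubini_F /=.
have gE : (\int[m2]_y (g y)%:E)%E = (\int[m2]_y g y)%:E.
  by rewrite fineK//; exact: integrable_fin_num.
under eq_integral => x _.
  under eq_integral => y _ do rewrite EFinM.
  rewrite integralZl// gE.
  over.
by rewrite /= integralZr// fineM//; exact: integrable_fin_num.
Qed.

(** The measure on [n.+1]-tuples is a product measure pushed forward along [tuple_cons], so Fubini
    splits off one factor at each induction step; for [n = 0] it is a Dirac mass and the product is
    empty. *)
Lemma tuple_tensor (R : realType) n (f : 'I_n -> measurableTypeR R -> R) :
  (forall i, lebesgue_measure.-integrable setT (EFin \o f i)) ->
  (tuple_lebesgue_measure R n).-integrable setT
    (EFin \o (fun x => \prod_(i < n) f i (tnth x i))) /\
  \int[tuple_lebesgue_measure R n]_x (\prod_(i < n) f i (tnth x i)) =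
    \prod_(i < n) \int[lebesgue_measure]_x f i x.
Proof.
elim: n f => [f _|n IH f intf].
  split.
    rewrite (_ : _ \o _ = cst 1%E); last first.
      by apply/funext => x /=; rewrite big_ord0.
    apply/integrableP; split=> //=.
    under eq_integral do rewrite /= normr1.
    by rewrite integral_dirac// diracT mul1e ltry.
  rewrite big_ord0 /Rintegral /=.
  under eq_integral do rewrite big_ord0.
  by rewrite integral_dirac// diracT mul1e.
have [IH1 IH2] := IH (fun i => f (lift ord0 i)) (fun i => intf _).
pose F (x : n.+1.-tuple (measurableTypeR R)) := \prod_(i < n.+1) f i (tnth x i).
have FE : (EFin \o F) \o @tuple_cons R n =
    EFin \o (fun z => f ord0 z.1 * \prod_(i < n) f (lift ord0 i) (tnth z.2 i)).
  apply/funext => -[x y]; rewrite /F /= big_ord_recl; congr (_ * _)%:E.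
  by apply: eq_bigr => i _; rewrite tnthS.
have mF : measurable_fun setT (EFin \o F).
  apply/measurable_EFinP/measurable_prod => i _.
  have mfi : measurable_fun setT (f i).
    by apply/measurable_EFinP; exact: measurable_int (intf i).
  exact: (measurableT_comp mfi (measurable_tnth i)).
have intFc : (lebesgue_measure \x tuple_lebesgue_measure R n)%E.-integrable setT
    ((EFin \o F) \o @tuple_cons R n).
  by rewrite FE; exact: (integrable_prod_tensor (intf ord0) IH1).
split.
  exact: (integrable_pushforward (@measurable_tuple_cons R n)).
rewrite {1}/Rintegral /= -/F.
have -> : (\int[tuple_lebesgue_step (tuple_lebesgue_measure R n)]_x (F x)%:E =
    \int[(lebesgue_measure \x tuple_lebesgue_measure R n)%E]_x
      ((EFin \o F) \o @tuple_cons R n) x)%E.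
  exact: (integral_pushforward (@measurable_tuple_cons R n)).
by rewrite FE big_ord_recl -IH2 -(Rintegral_prod_tensor (intf ord0) IH1).
Qed.

Lemma Rintegral_sum d (T : measurableType d) (R : realType)
    (mu : {measure set T -> \bar R}) (D : set T) (I : Type) (s : seq I)
    (P : pred I) (f : I -> T -> R) :
  measurable D -> (forall i, P i -> mu.-integrable D (EFin \o f i)) ->
  \int[mu]_(x in D) (\sum_(i <- s | P i) f i x) =
  \sum_(i <- s | P i) \int[mu]_(x in D) f i x.
Proof.
move=> mD intf.
have sumE i0 : EFin \o (fun x => \sum_(i <- i0 | P i) f i x) =
    (fun x => (\sum_(i <- i0 | P i) (EFin \o f i) x)%E).
  by apply/funext => x /=; rewrite sumEFin.
elim: s => [|i s IH].
  by under eq_Rintegral do rewrite big_nil; rewrite big_nil Rintegral_cst ?mul0r.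
under eq_Rintegral do rewrite big_cons; rewrite big_cons.
case: ifPn => // Pi; rewrite RintegralD ?IH//; first exact: intf.
by rewrite sumE; exact: integrable_sum.
Qed.

(** * Bessel's inequality for orthogonal families *)

Section bessel.
Context d (T : measurableType d) (R : realType).
Variables (mu : {measure set T -> \bar R}) (D : set T).
Hypothesis mD : measurable D.
Variables (I : finType) (P : pred I) (F : T -> R) (phi : I -> T -> R).
Hypothesis intFF : mu.-integrable D (EFin \o (fun x => F x * F x)).
Hypothesis intFp : forall i, P i ->
  mu.-integrable D (EFin \o (fun x => F x * phi i x)).
Hypothesis intpp : forall i j, P i -> P j ->
  mu.-integrable D (EFin \o (fun x => phi i x * phi j x)).
Hypothesis orth : forall i j, P i -> P j -> i != j ->
  \int[mu]_(x in D) (phi i x * phi j x) = 0.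
Hypothesis norm_gt0 : forall i, P i -> 0 < \int[mu]_(x in D) (phi i x * phi i x).

Lemma bessel_inequality :
  \sum_(i | P i) (\int[mu]_(x in D) (F x * phi i x)) ^+ 2 /
                 \int[mu]_(x in D) (phi i x * phi i x)
  <= \int[mu]_(x in D) (F x * F x).
Proof.
pose a i := \int[mu]_(x in D) (F x * phi i x).
pose b i := \int[mu]_(x in D) (phi i x * phi i x).
pose c i := a i / b i.
pose G1 x := \sum_(i | P i) c i * (F x * phi i x).
pose G2 x := \sum_(i | P i) \sum_(j | P j) c i * c j * (phi i x * phi j x).
have intG1i i : P i -> mu.-integrable D (EFin \o (fun x => c i * (F x * phi i x))).
  move=> Pi; rewrite (_ : _ \o _ = (fun x => (c i)%:E * (F x * phi i x)%:E)%E)//.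
  by apply: integrableZl => //; exact: intFp.
have intG2ij i j : P i -> P j ->
    mu.-integrable D (EFin \o (fun x => c i * c j * (phi i x * phi j x))).
  move=> Pi Pj.
  rewrite (_ : _ \o _ = (fun x => (c i * c j)%:E * (phi i x * phi j x)%:E)%E)//.
  by apply: integrableZl => //; exact: intpp.
have intG2i i : P i -> mu.-integrable D
    (EFin \o (fun x => \sum_(j | P j) c i * c j * (phi i x * phi j x))).
  move=> Pi; rewrite (_ : _ \o _ = (fun x =>
      \sum_(j | P j) (EFin \o (fun x => c i * c j * (phi i x * phi j x))%R) x)%E).
    by apply: integrable_sum => // j Pj; exact: intG2ij.
  by apply/funext => x /=; rewrite sumEFin.
have intG1 : mu.-integrable D (EFin \o G1).
  rewrite (_ : _ \o _ = (fun x =>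
      \sum_(i | P i) (EFin \o (fun x => c i * (F x * phi i x))%R) x)%E).
    exact: integrable_sum.
  by apply/funext => x /=; rewrite sumEFin.
have intG2 : mu.-integrable D (EFin \o G2).
  rewrite (_ : _ \o _ = (fun x => \sum_(i | P i)
      (EFin \o (fun x => \sum_(j | P j) c i * c j * (phi i x * phi j x))%R) x)%E).
    exact: integrable_sum.
  by apply/funext => x /=; rewrite sumEFin.
have IG1 : \int[mu]_(x in D) G1 x = \sum_(i | P i) a i ^+ 2 / b i.
  rewrite Rintegral_sum//; apply: eq_bigr => i Pi.
  by rewrite RintegralZl//; [rewrite -/(a i) /c; ring|exact: intFp].
have IG2 : \int[mu]_(x in D) G2 x = \sum_(i | P i) a i ^+ 2 / b i.
  rewrite Rintegral_sum//; apply: eq_bigr => i Pi.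
  rewrite Rintegral_sum; [|by []|by move=> j Pj; exact: intG2ij].
  rewrite (bigD1 i)//= big1 ?addr0 => [|j /andP[Pj ji]].
    rewrite RintegralZl//; last exact: intpp.
    have : b i != 0 by rewrite gt_eqF// norm_gt0.
    by rewrite -/(b i) /c => bi0; field.
  by rewrite RintegralZl ?orth ?mulr0//; [rewrite eq_sym|exact: intpp].
(* The integrand is the square of the remainder [F - \sum_i c i * phi i]. It is grouped so that,
   [G1] and [G2] having equal integrals, the second bracket integrates to 0. *)
have : 0 <= \int[mu]_(x in D) ((F x * F x - G1 x) - (G1 x - G2 x)).
  apply: Rintegral_ge0 => x _.
  rewrite (_ : _ - _ = (F x - \sum_(i | P i) c i * phi i x) ^+ 2) ?sqr_ge0//.
  have -> : G1 x = F x * \sum_(i | P i) c i * phi i x.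
    by rewrite mulr_sumr; apply: eq_bigr => i _; ring.
  have -> : G2 x = (\sum_(i | P i) c i * phi i x) ^+ 2.
    rewrite expr2 mulr_suml; apply: eq_bigr => i _.
    by rewrite mulr_sumr; apply: eq_bigr => j _; ring.
  ring.
have intB f g : mu.-integrable D (EFin \o f) -> mu.-integrable D (EFin \o g) ->
    mu.-integrable D (EFin \o (fun x => f x - g x)).
  by move=> intf intg; exact: (integrableB mD intf intg).
rewrite RintegralB//; [|exact: intB..].
rewrite RintegralB// RintegralB// IG1 IG2 subrr subr0.
by rewrite subr_ge0.
Qed.

End bessel.

(** * Tensor products on the unit cube *)

Section cube.
Variable R : realType.
Notation leb := (@lebesgue_measure R).
Implicit Types f g h : R -> R.

(** The bound is asked only where the integrals are taken, so that the identity qualifies. *)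
Definition unit_bounded f :=
  measurable_fun (setT : set (measurableTypeR R)) f /\ (forall x, 0 <= x < 1 -> `|f x| <= 1).

Definition inner f g := \int[leb]_(x in `[0, 1[) (f x * g x).

Lemma unit_boundedM f g :
  unit_bounded f -> unit_bounded g -> unit_bounded (fun x => f x * g x).
Proof.
move=> [mf bf] [mg bg]; split; first exact: measurable_funM.
by move=> x x01; rewrite normrM mulr_ile1// ?bf ?bg.
Qed.

Lemma unit_bounded_integrable f (A : set (measurableTypeR R)) :
  measurable A -> A `<=` `[0, 1[ ->
  unit_bounded f -> leb.-integrable A (EFin \o f).
Proof.
move=> mA A01 [mf bf].
suff intf : leb.-integrable `[0, 1[ (EFin \o f) by exact: integrableS intf.
apply: measurable_bounded_integrable => //=.
- by rewrite lebesgue_measure_itv/= lte_fin ltr01 -EFinD ltry.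
- exact: measurable_funTS.
- exists 1; split => // r r1 x /=; rewrite in_itv/= => x01.
  by rewrite (le_trans (bf _ x01))// ltW.
Qed.

Lemma measurable_unit_cube n :
  measurable (@unit_cube R n : set (n.-tuple (measurableTypeR R))).
Proof.
rewrite (_ : @unit_cube R n = \bigcap_(i in [set: 'I_n])
    ((fun x : n.-tuple (measurableTypeR R) => tnth x i) @^-1` `[0, 1[)).
  apply: fin_bigcap_measurable => // i _.
  by rewrite -[X in measurable X]setTI; apply: measurable_tnth.
apply/seteqP; split => x /= xI i; first by move=> _; rewrite /= in_itv/=; exact: xI.
by have := xI i I; rewrite /= in_itv.
Qed.

Definition tensor n (f : 'I_n -> R -> R) (x : n.-tuple R) : R :=
  \prod_(i < n) f i (tnth x i).

Lemma tensorM n (f g : 'I_n -> R -> R) x :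
  tensor f x * tensor g x = tensor (fun i y => f i y * g i y) x.
Proof. by rewrite /tensor -big_split. Qed.

(** This reduces integrals over the cube to the whole-space integrals of [tuple_tensor]. *)
Lemma tensor_restrict n (f : 'I_n -> R -> R) :
  tensor f \_ (@unit_cube R n) = tensor (fun i => f i \_ `[0, 1[).
Proof.
apply/funext => x; rewrite /tensor patchE; case: ifPn => [|xC].
  rewrite inE => xC; apply: eq_bigr => i _.
  by rewrite patchE mem_set//= in_itv/=; exact: xC.
have [i xi] : exists i, ~ (0 <= tnth x i < 1).
  by apply/existsNP => xC'; move: xC; rewrite mem_set.
by rewrite (bigD1 i)//= patchE memNset ?mul0r//= in_itv.
Qed.

Lemma cube_tensor n (f : 'I_n -> R -> R) : (forall i, unit_bounded (f i)) ->
  (tuple_lebesgue_measure R n).-integrable (@unit_cube R n) (EFin \o tensor f) /\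
  \int[tuple_lebesgue_measure R n]_(x in @unit_cube R n) tensor f x =
    \prod_(i < n) \int[leb]_(x in `[0, 1[) f i x.
Proof.
move=> fb.
have intf i : leb.-integrable setT (EFin \o (f i \_ `[0, 1[)).
  have m01 : measurable (`[0, 1[ : set (measurableTypeR R)) by [].
  rewrite -restrict_EFin; apply: (integrable_mkcond _ m01).1.
  exact: (unit_bounded_integrable m01 (@subset_refl _ _) (fb i)).
have [int1 int2] := tuple_tensor intf; split.
  refine ((integrable_mkcond (mu := tuple_lebesgue_measure R n)
    (EFin \o tensor f) (@measurable_unit_cube n)).2 _).
  by rewrite restrict_EFin tensor_restrict.
rewrite Rintegral_mkcond tensor_restrict int2.
by apply: eq_bigr => i _; rewrite -Rintegral_mkcond.
Qed.

End cube.

Section tensor_combination.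
Variables (R : realType) (n : nat).
Local Notation mu := (tuple_lebesgue_measure R n).
Local Notation cube := (@unit_cube R n).

Lemma cube_tensorM (f g : 'I_n -> R -> R) :
  (forall i, unit_bounded (f i)) -> (forall i, unit_bounded (g i)) ->
  mu.-integrable cube (EFin \o (fun x => tensor f x * tensor g x)) /\
  \int[mu]_(x in cube) (tensor f x * tensor g x) =
    \prod_(i < n) inner (f i) (g i).
Proof.
move=> fb gb.
have [int1 int2] := cube_tensor (fun i => unit_boundedM (fb i) (gb i)).
have -> : (fun x => tensor f x * tensor g x) =
    tensor (fun i y => f i y * g i y) by apply/funext => x; exact: tensorM.
by split => //; rewrite -int2; apply: eq_Rintegral => x _; exact: tensorM.
Qed.

Variables (I : Type) (s : seq I) (c : I -> R) (g : I -> 'I_n -> R -> R).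
Hypothesis gb : forall i u, unit_bounded (g i u).

(** The discrepancy function has this shape: each point indicator and the volume [x_1 ... x_d] is a
    tensor. *)
Let comb x := \sum_(i <- s) c i * tensor (g i) x.

Let integrableZ (a : R) (f : n.-tuple R -> R) :
  mu.-integrable cube (EFin \o f) -> mu.-integrable cube (EFin \o (fun x => a * f x)).
Proof. by move=> intf; exact: (integrableZl (@measurable_unit_cube R n) a intf). Qed.

Let integrable_comb (f : I -> n.-tuple R -> R) :
  (forall i, mu.-integrable cube (EFin \o f i)) ->
  mu.-integrable cube (EFin \o (fun x => \sum_(i <- s) c i * f i x)).
Proof.
move=> intf; rewrite (_ : _ \o _ = (fun x =>
    \sum_(i <- s) (EFin \o (fun x => c i * f i x)%R) x)%E); last first.
  by apply/funext => x /=; rewrite sumEFin.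
apply: integrable_sum; first exact: (@measurable_unit_cube R n).
by move=> i _; exact: integrableZ.
Qed.

Lemma integrable_comb_sqr :
  mu.-integrable cube (EFin \o (fun x => comb x * comb x)).
Proof.
rewrite (_ : _ \o _ = EFin \o (fun x => \sum_(i <- s) c i *
    (\sum_(j <- s) c j * (tensor (g j) x * tensor (g i) x)))).
  apply: (@integrable_comb (fun i x =>
    \sum_(j <- s) c j * (tensor (g j) x * tensor (g i) x))) => i.
  apply: (@integrable_comb (fun j x => tensor (g j) x * tensor (g i) x)) => j.
  by have [] := cube_tensorM (gb j) (gb i).
apply/funext => x /=; congr EFin; rewrite /comb mulr_suml; apply: eq_bigr => i _.
by rewrite -mulrA mulr_sumr; congr (_ * _); apply: eq_bigr => j _; ring.
Qed.

Lemma comb_tensor (f : 'I_n -> R -> R) : (forall u, unit_bounded (f u)) ->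
  mu.-integrable cube (EFin \o (fun x => comb x * tensor f x)) /\
  \int[mu]_(x in cube) (comb x * tensor f x) =
    \sum_(i <- s) c i * \prod_(u < n) inner (g i u) (f u).
Proof.
move=> fb.
have E x : comb x * tensor f x = \sum_(i <- s) c i * (tensor (g i) x * tensor f x).
  by rewrite /comb mulr_suml; apply: eq_bigr => i _; rewrite mulrA.
split.
  rewrite (_ : (fun x => comb x * tensor f x) =
    (fun x => \sum_(i <- s) c i * (tensor (g i) x * tensor f x))); last exact/funext.
  apply: (@integrable_comb (fun i x => tensor (g i) x * tensor f x)) => i.
  by have [] := cube_tensorM (gb i) fb.
under eq_Rintegral do rewrite E.
have inti i := cube_tensorM (gb i) fb.
rewrite Rintegral_sum; [|exact: (@measurable_unit_cube R n)|].
  apply: eq_bigr => i _; have [int1 int2] := inti i.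
  by rewrite RintegralZl ?int2//; exact: (@measurable_unit_cube R n).
by move=> i _; apply: integrableZ; have [] := inti i.
Qed.

End tensor_combination.

(** * Bessel's inequality for the discrepancy function *)

Section discrepancy_bessel.
Variables (R : realType) (n : nat) (P : {fset n.-tuple R}).
Local Notation mu := (tuple_lebesgue_measure R n).
Local Notation cube := (@unit_cube R n).

Lemma unit_bounded_id : unit_bounded (@id R).
Proof.
split; first exact: measurable_id.
by move=> x /andP[x0 x1]; rewrite ger0_norm// ltW.
Qed.

Lemma unit_bounded_indic (A : set (measurableTypeR R)) :
  measurable A -> unit_bounded (\1_A : R -> R).
Proof.
move=> mA; split; first exact: measurable_indic.
by move=> x _; rewrite indicE; case: (_ \in _); rewrite /= ?normr1 ?normr0.
Qed.

Lemma indic_upper_box (z x : n.-tuple R) :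
  \1_(upper_box z) x = tensor (fun i => \1_`]tnth z i, 1[ ) x :> R.
Proof.
rewrite indicE /tensor; have [zx|zx] := pselect (upper_box z x).
  rewrite mem_set// big1// => i _; rewrite indicE mem_set//= in_itv/=.
  exact: zx.
have [i xi] : exists i, ~ (tnth z i < tnth x i < 1) by exact/existsNP.
by rewrite memNset// (bigD1 i)//= indicE memNset ?mul0r//= in_itv.
Qed.

(** Inner products of tensors are products over the coordinates, so orthogonality in a single
    coordinate is enough. *)
Lemma discrepancy_bessel (A : finType) (Q : pred A) (phi : A -> 'I_n -> R -> R) :
  (forall a u, unit_bounded (phi a u)) ->
  (forall a b, Q a -> Q b -> a != b -> exists u, inner (phi a u) (phi b u) = 0) ->
  (forall a u, Q a -> 0 < inner (phi a u) (phi a u)) ->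
  \sum_(a | Q a)
    (\sum_(z <- P) \prod_(u < n) inner \1_`]tnth z u, 1[ (phi a u)
     - #|` P|%:R * \prod_(u < n) inner id (phi a u)) ^+ 2
    / \prod_(u < n) inner (phi a u) (phi a u)
  <= \int[mu]_(x in cube) discrepancy P x ^+ 2.
Proof.
move=> phib orth norm.
(* [None] stands for the volume term, weighted by minus the number of points, and [Some z] for the
   indicator of [upper_box z]. *)
pose c (o : option (n.-tuple R)) : R := if o is Some _ then 1 else - #|` P|%:R.
pose g (o : option (n.-tuple R)) (i : 'I_n) : R -> R :=
  if o is Some z then \1_`]tnth z i, 1[ else id.
pose s : seq (option (n.-tuple R)) := None :: map Some P.
have gb o u : unit_bounded (g o u).
  by case: o => [z|] /=; [exact: unit_bounded_indic|exact: unit_bounded_id].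
have DE x : discrepancy P x = \sum_(o <- s) c o * tensor (g o) x.
  rewrite /discrepancy big_cons big_map /= mulNr addrC; congr (_ + _).
  by apply: eq_bigr => z _; rewrite mul1r indic_upper_box.
have intDp a := comb_tensor s c gb (phib a).
have intpp a b := cube_tensorM (phib a) (phib b).
have := @bessel_inequality _ _ _ mu cube (@measurable_unit_cube R n) A Q
  (fun x => \sum_(o <- s) c o * tensor (g o) x) (fun a => tensor (phi a))
  (integrable_comb_sqr s c gb) (fun a _ => (intDp a).1)
  (fun a b _ _ => (intpp a b).1).
have -> : \int[mu]_(x in cube) discrepancy P x ^+ 2 = \int[mu]_(x in cube)
    ((\sum_(o <- s) c o * tensor (g o) x) * (\sum_(o <- s) c o * tensor (g o) x)).
  by apply: eq_Rintegral => x _; rewrite DE expr2.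
move=> bessel; apply: le_trans (bessel _ _).
- rewrite le_eqVlt; apply/orP; left; apply/eqP; apply: eq_bigr => a Qa.
  rewrite (intDp a).2 (intpp a a).2 big_cons big_map /= mulNr [in RHS]addrC.
  congr ((_ - _) ^+ 2 / _); apply: eq_bigr => z _.
  by rewrite mul1r.
- move=> a b Qa Qb ab; rewrite (intpp a b).2.
  by have [u uE] := orth _ _ Qa Qb ab; rewrite (bigD1 u)//= uE mul0r.
- by move=> a Qa; rewrite (intpp a a).2; apply: prodr_gt0 => u _; exact: norm.
Qed.

End discrepancy_bessel.

(** * One-dimensional Haar functions *)

Section haar.
Variable R : realType.
Notation leb := (@lebesgue_measure R).
Implicit Types (f g : R -> R) (a b c u v w x z : R).

Lemma innerC f g : inner f g = inner g f.
Proof. by apply: eq_Rintegral => x _; rewrite mulrC. Qed.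

Lemma inner_indic f a b : 0 <= a -> b <= 1 ->
  inner f \1_`[a, b[ = \int[leb]_(x in `[a, b[) f x.
Proof.
move=> a0 b1; rewrite /inner.
have -> : `[a, b[%classic = `[0, 1[%classic `&` `[a, b[%classic :> set R.
  apply/seteqP; split => x /=; rewrite !in_itv/=; last by case.
  by move=> /andP[ax xb]; rewrite ax xb (le_trans a0 ax) (lt_le_trans xb b1).
rewrite Rintegral_mkcondr; apply: eq_Rintegral => x; rewrite inE => x01.
rewrite indicE patchE in_setI mem_set// andTb.
by case: (_ \in _); rewrite /= ?mulr1 ?mulr0.
Qed.

Lemma Rintegral_itv_cst f v a b : a <= b -> (forall x, a <= x < b -> f x = v) ->
  \int[leb]_(x in `[a, b[) f x = v * (b - a).
Proof.
move=> ab fv; rewrite (@eq_Rintegral _ _ _ _ _ (cst v)); last first.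
  by move=> x; rewrite inE/= in_itv/=; exact: fv.
rewrite Rintegral_cst//= lebesgue_measure_itv/= lte_fin.
case: ltP => //= ba; have -> : b = a by apply/eqP; rewrite eq_le ab ba.
by rewrite subrr.
Qed.

Lemma Rintegral_itv_id a b : 0 <= a -> a < b -> b <= 1 ->
  \int[leb]_(x in `[a, b[) x = (b ^+ 2 - a ^+ 2) / 2.
Proof.
move=> a0 ab b1; rewrite Rintegral_itv_bndo_bndc; last first.
  apply: unit_bounded_integrable; [by []| |exact: unit_bounded_id].
  move=> x /=; rewrite !in_itv/= => /andP[ax xb].
  by rewrite (le_trans a0 ax) (lt_le_trans xb b1).
have dF (y0 : R) : is_derive y0 1 (fun y : R => 2^-1 * y ^+ 2) y0.
  by apply: is_derive_eq; rewrite /GRing.scale/=; field.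
have cF : continuous (fun y : R => 2^-1 * y ^+ 2).
  by move=> y; apply/differentiable_continuous/derivable1_diffP; exact: ex_derive.
have FTC : (\int[leb]_(x in `[a, b]) x%:E =
    (2^-1 * b ^+ 2)%:E - (2^-1 * a ^+ 2)%:E)%E.
  apply: (continuous_FTC2 (f := id) (F := fun y : R => 2^-1 * y ^+ 2) ab).
  - by apply: continuous_subspaceT => x; exact: cvg_id.
  - split => [x _||]; first exact: ex_derive.
      exact/cvg_at_right_filter/cF.
    exact/cvg_at_left_filter/cF.
  - by move=> x _; rewrite derive1E; have [_ ->] := dF x.
by rewrite /Rintegral FTC -EFinB/=; field.
Qed.

End haar.

Section haar_function.
Variable R : realType.
Notation leb := (@lebesgue_measure R).
Implicit Types (f g : R -> R) (c v w x z : R) (e k l p q : nat).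

Definition cell w k : set R := `[k%:R * w, k.+1%:R * w[%classic.

Lemma cellP w k x : cell w k x <-> k%:R * w <= x < k.+1%:R * w.
Proof. by rewrite /cell /= in_itv. Qed.

Lemma cell_inj w k l x : 0 < w -> cell w k x -> cell w l x -> k = l.
Proof.
move=> w0 /cellP/andP[kx xk] /cellP/andP[lx xl].
have := le_lt_trans kx xl; have := le_lt_trans lx xk.
by rewrite !ltr_pM2r// !ltr_nat !ltnS => lk kl; apply/eqP; rewrite eqn_leq lk kl.
Qed.

Lemma cell_coarsen w e k x :
  0 < w -> cell w k x -> cell (w * (2 ^ e)%:R) (k %/ 2 ^ e) x.
Proof.
move=> w0 /cellP/andP[kx xk]; apply/cellP.
have ke : (k %/ 2 ^ e * 2 ^ e <= k < (k %/ 2 ^ e).+1 * 2 ^ e)%N.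
  by rewrite leq_divM ltn_ceil// expn_gt0.
have /andP[h1 h2] := ke.
apply/andP; split.
  by rewrite mulrCA -natrM mulrC (le_trans _ kx)// ler_pM2r// ler_nat.
by rewrite mulrCA -natrM mulrC (lt_le_trans xk)// ler_pM2r// ler_nat.
Qed.

Lemma cell_double w k x : 0 < w -> cell (w * 2) k x <->
  cell w (2 * k) x \/ cell w (2 * k + 1) x.
Proof.
move=> w0; rewrite !cellP.
have -> : k.+1%:R * (w * 2) = (2 * k).+2%:R * w by ring.
have -> : k%:R * (w * 2) = (2 * k)%:R * w by ring.
rewrite addn1; split => [/andP[kx xk]|[/andP[kx xk]|/andP[kx xk]]].
- by have [h|h] := ltP x ((2 * k).+1%:R * w);
    [left; rewrite kx ?h|right; rewrite ?h xk].
- by rewrite kx (lt_trans xk)// ltr_pM2r// ltr_nat.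
- by rewrite xk (le_trans _ kx)// ler_pM2r// ler_nat.
Qed.

(* [w] is half the length of the support. *)
Definition haar w p x : R := \1_(cell w (2 * p)) x - \1_(cell w (2 * p + 1)) x.

Lemma haar_cell w p k x : 0 < w -> cell w k x ->
  haar w p x = (k == 2 * p)%:R - (k == 2 * p + 1)%:R.
Proof.
move=> w0 wx.
have E l : \1_(cell w l) x = (k == l)%:R :> R.
  rewrite indicE; have [<-|kl] := eqVneq; first by rewrite mem_set.
  by rewrite memNset// => /(cell_inj w0 wx) /eqP; exact/negP.
by rewrite /haar !E.
Qed.

Lemma unit_bounded_haar w p : 0 < w -> unit_bounded (haar w p).
Proof.
move=> w0; split.
  by apply: measurable_funB; apply: measurable_indic => //; exact: measurable_itv.
move=> x _; rewrite /haar !indicE.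
have [h|h] := boolP (x \in cell w (2 * p));
  have [h'|h'] := boolP (x \in cell w (2 * p + 1)); rewrite ?subrr ?subr0 ?sub0r
  ?normrN ?normr1 ?normr0//.
Qed.

Section inner_haar.
Variables (w : R) (p : nat).
Hypotheses (w0 : 0 < w) (w1 : p.+1%:R * (w * 2) <= 1).

(** By [w1] the support lies in [[0, 1[], so restricting to the unit interval cuts nothing off. *)
Lemma inner_haar f : unit_bounded f -> inner f (haar w p) =
  \int[leb]_(x in cell w (2 * p)) f x - \int[leb]_(x in cell w (2 * p + 1)) f x.
Proof.
move=> fb.
have h0 k : 0 <= k%:R * w by rewrite mulr_ge0// ltW.
have h1 k : (k < (2 * p).+2)%N -> k.+1%:R * w <= 1.
  move=> kp; apply: le_trans w1.
  have -> : p.+1%:R * (w * 2) = (2 * p).+2%:R * w by ring.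
  by rewrite ler_pM2r// ler_nat.
rewrite /cell -!inner_indic ?h0 ?h1 ?addn1// -/(cell _ _) -/(cell _ _).
rewrite /inner -RintegralB//.
- by apply: eq_Rintegral => x _; rewrite /haar addn1; ring.
- apply: unit_bounded_integrable => //; apply: unit_boundedM => //.
  by apply: unit_bounded_indic; exact: measurable_itv.
- apply: unit_bounded_integrable => //; apply: unit_boundedM => //.
  by apply: unit_bounded_indic; exact: measurable_itv.
Qed.

Lemma Rintegral_cell_cst f v k : (forall x, cell w k x -> f x = v) ->
  \int[leb]_(x in cell w k) f x = v * w.
Proof.
move=> fv; rewrite (@Rintegral_itv_cst _ _ v); first by rewrite -natr1; ring.
  by rewrite ler_pM2r// ler_nat.
by move=> x xk; apply: fv; apply/cellP.
Qed.

(** A Haar function has mean zero. The vanishing inner products below, with coarser or disjoint Haar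
    functions, with constants and with indicators of points outside the support, all come from
    this. *)
Lemma inner_haar_cst f v : unit_bounded f ->
  (forall x, cell (w * 2) p x -> f x = v) -> inner f (haar w p) = 0.
Proof.
move=> fb fv; rewrite inner_haar// !(@Rintegral_cell_cst f v) ?subrr// => x px.
  by apply: fv; apply/cell_double => //; right.
by apply: fv; apply/cell_double => //; left.
Qed.

Lemma inner_haar_haar : inner (haar w p) (haar w p) = w * 2.
Proof.
rewrite inner_haar; last exact: unit_bounded_haar.
rewrite (@Rintegral_cell_cst _ 1) => [|x px]; last first.
  by rewrite (haar_cell p w0 px) eqxx; case: eqVneq; [lia|rewrite subr0].
rewrite (@Rintegral_cell_cst _ (-1)) => [|x px]; last first.
  by rewrite (haar_cell p w0 px) eqxx; case: eqVneq; [lia|rewrite sub0r].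
by ring.
Qed.

Lemma inner_id_haar : inner id (haar w p) = - w ^+ 2.
Proof.
have h0 k : 0 <= k%:R * w by rewrite mulr_ge0// ltW.
have h1 k : (k < (2 * p).+2)%N -> k.+1%:R * w <= 1.
  move=> kp; apply: le_trans w1.
  have -> : p.+1%:R * (w * 2) = (2 * p).+2%:R * w by ring.
  by rewrite ler_pM2r// ler_nat.
rewrite inner_haar; last exact: unit_bounded_id.
by rewrite !Rintegral_itv_id ?h0 ?h1 ?ltr_pM2r ?ltr_nat ?addn1//; field.
Qed.

(** On the support the indicator is constantly 0 if [z] lies to the right of it and constantly 1 if
    [z] lies to the left. *)
Lemma inner_indic_haar z : 0 <= z < 1 -> ~ cell (w * 2) p z ->
  inner \1_`]z, 1[ (haar w p) = 0.
Proof.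
move=> /andP[z0 z1] zp.
have b : unit_bounded (\1_`]z, 1[ : R -> R) by exact: unit_bounded_indic.
have [pz|zp'] := leP (p%:R * (w * 2)) z.
  apply: (@inner_haar_cst _ 0) => // x /cellP/andP[px xp].
  rewrite indicE memNset//= in_itv/= => /andP[zx _]; apply: zp; apply/cellP.
  by rewrite pz (lt_trans zx xp).
apply: (@inner_haar_cst _ 1) => // x /cellP/andP[px xp].
by rewrite indicE mem_set//= in_itv/= (lt_le_trans zp' px) (lt_le_trans xp w1).
Qed.

End inner_haar.

(** Each half of the coarser support consists of [2 ^ e] cells of length [w * 2], and the finer
    support is one such cell; hence the coarser function is constant on it. *)
Lemma inner_haar_finer w e p p' : 0 < w -> p'.+1%:R * (w * 2) <= 1 ->
  inner (haar (w * 2 * (2 ^ e)%:R) p) (haar w p') = 0.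
Proof.
move=> w0 w1; have w20 : 0 < w * 2 by rewrite mulr_gt0.
have W0 : 0 < w * 2 * (2 ^ e)%:R by rewrite mulr_gt0// ltr0n expn_gt0.
apply: (@inner_haar_cst _ _ _ _ _ (((p' %/ 2 ^ e)%N == 2 * p)%:R
                                   - ((p' %/ 2 ^ e)%N == 2 * p + 1)%:R)) => //.
  exact: unit_bounded_haar.
by move=> x px; apply: haar_cell => //; exact: cell_coarsen.
Qed.

Lemma inner_haar_disjoint w p p' : 0 < w -> p'.+1%:R * (w * 2) <= 1 ->
  p != p' -> inner (haar w p) (haar w p') = 0.
Proof.
move=> w0 w1 pp'; apply: (@inner_haar_cst _ _ _ _ _ 0) => //.
  exact: unit_bounded_haar.
move=> x /cell_double[]// px; rewrite (haar_cell p w0 px);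
  do 2 (case: eqVneq => ?; first by move/eqP: pp'; lia); by rewrite subrr.
Qed.

(* Levels [l] of the Haar system with supports of length [c * 2 ^- l]. *)
Definition haar_level c l : nat -> R -> R := haar (c * 2 ^- l.+1).

Lemma inner_haar_level c l p l' p' : 0 < c ->
  p.+1%:R * (c * 2 ^- l) <= 1 -> p'.+1%:R * (c * 2 ^- l') <= 1 ->
  (l, p) != (l', p') -> inner (haar_level c l p) (haar_level c l' p') = 0.
Proof.
move=> c0.
have wE k : c * 2 ^- k.+1 * 2 = c * 2 ^- k.
  by rewrite exprSr invfM; field; rewrite expf_neq0.
have w0 k : 0 < c * 2 ^- k by rewrite mulr_gt0// invr_gt0 exprn_gt0.
(* Half a support at level [a] has the length of [2 ^ b] whole supports at level [a + b + 1]. *)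
have W a b : c * 2 ^- a.+1 = c * 2 ^- (a + b).+2 * 2 * (2 ^ b)%:R.
  rewrite wE natrX -addSn exprD invfM; field.
  by rewrite !expf_neq0.
rewrite /haar_level => h h'; have [ll'|l'l|->] := ltngtP l l'.
- have [b lE] : exists b, l' = (l + b).+1 by exists (l' - l.+1)%N; lia.
  move=> _; rewrite lE (W l b); apply: inner_haar_finer; first exact: w0.
  by rewrite wE -lE.
- have [b lE] : exists b, l = (l' + b).+1 by exists (l - l'.+1)%N; lia.
  move=> _; rewrite lE (W l' b) innerC; apply: inner_haar_finer; first exact: w0.
  by rewrite wE -lE.
- rewrite xpair_eqE eqxx/= => pp'; apply: inner_haar_disjoint => //.
  by rewrite wE.
Qed.

End haar_function.

(** * Contribution of the empty boxes *)

Section wavelet_systems.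
Variables (R : realType) (n : nat) (P : {fset n.-tuple R}).
Hypothesis P01 : forall z : n.-tuple R, z \in P -> unit_cube z.
(** An abstract system per coordinate [u], with level [l] and position [p < cnt u l], since the
    first coordinate will carry a different system from the others. [kappa u l] is the square of the
    normalised coefficient of the identity, the same at all positions of a level. *)
Variables (phi : 'I_n -> nat -> nat -> R -> R) (supp : 'I_n -> nat -> nat -> set R).
Variables (cnt : 'I_n -> nat -> nat) (kappa : 'I_n -> nat -> R).
Hypothesis phi_bounded : forall u l p, unit_bounded (phi u l p).
Hypothesis phi_orth : forall u l p l' p', (p < cnt u l)%N -> (p' < cnt u l')%N ->
  (l, p) != (l', p') -> inner (phi u l p) (phi u l' p') = 0.
Hypothesis phi_norm : forall u l p, (p < cnt u l)%N ->
  0 < inner (phi u l p) (phi u l p).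
Hypothesis phi_id : forall u l p, (p < cnt u l)%N ->
  inner id (phi u l p) ^+ 2 / inner (phi u l p) (phi u l p) = kappa u l.
Hypothesis kappa_ge0 : forall u l, 0 <= kappa u l.
Hypothesis phi_indic : forall u l p (z : R), (p < cnt u l)%N -> 0 <= z < 1 ->
  ~ supp u l p z -> inner \1_`]z, 1[ (phi u l p) = 0.
Hypothesis supp_inj : forall u l p p' z,
  supp u l p z -> supp u l p' z -> p = p'.

Let N : R := #|` P|%:R.

Section one_level.
Variables (Q : nat) (l : 'I_n -> nat).
Hypothesis cntQ : forall u, (cnt u (l u) <= Q)%N.

(** Positions are taken in a common ['I_Q], so that a box is a finite function; [valid] selects
    those that exist at the given levels. *)
Let valid := family (fun u => [pred j : 'I_Q | (j < cnt u (l u))%N]).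

Let box (p : {ffun 'I_n -> 'I_Q}) (z : n.-tuple R) : bool :=
  `[< forall u, supp u (l u) (p u) (tnth z u) >].

Let sum_valid : \sum_(p in valid) 1 = \prod_u (cnt u (l u))%:R :> R.
Proof.
transitivity (\prod_u \sum_(j : 'I_Q | (j < cnt u (l u))%N) (1 : R)).
  rewrite (bigA_distr_big_dep (fun u => [pred j : 'I_Q | (j < cnt u (l u))%N])).
  by apply: eq_bigr => p _; rewrite big1.
apply: eq_bigr => u _.
by rewrite -(big_ord_widen Q (fun=> 1) (cntQ u)) sumr_const card_ord.
Qed.

(** In every coordinate the point determines the position, so it lies in at most one box. *)
Let sum_box z : \sum_(p in valid) (box p z)%:R <= 1 :> R.
Proof.
have [p0 /asboolP zp0|nz] := pickP (box ^~ z); last first.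
  by rewrite big1// => p _; rewrite nz.
rewrite (@le_trans _ _ (\sum_(p in pred1 p0) 1))//; last first.
  by rewrite big_pred1_eq.
rewrite big_mkcond [leRHS]big_mkcond; apply: ler_sum => p _ /=.
rewrite [p \in pred1 p0]inE; have [->|pp0] := eqVneq p p0.
  by case: ifP => // _; rewrite lern1 leq_b1.
case: ifP => // _; rewrite (_ : box p z = false)//.
apply/negbTE/asboolPn => zp; move/eqP: pp0; apply; apply/ffunP => u.
by apply/val_inj; exact: supp_inj (zp u) (zp0 u).
Qed.

(** At most [N] boxes contain a point, and each empty box contributes exactly
    [N ^+ 2 * \prod_u kappa u (l u)]. *)
Lemma empty_boxes_sum :
  N ^+ 2 * \prod_u kappa u (l u) * (\prod_u (cnt u (l u))%:R - N) <=
  \sum_(p in valid)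
    (\sum_(z <- P) \prod_u inner \1_`]tnth z u, 1[ (phi u (l u) (p u))
     - N * \prod_u inner id (phi u (l u) (p u))) ^+ 2
    / \prod_u inner (phi u (l u) (p u)) (phi u (l u) (p u)).
Proof.
have NE : N = \sum_(z <- P) 1 by rewrite big_const_seq count_predT iter_addr_0.
have kappaE (p : {ffun 'I_n -> 'I_Q}) : p \in valid -> \prod_u kappa u (l u) =
    (\prod_u inner id (phi u (l u) (p u))) ^+ 2
    / \prod_u inner (phi u (l u) (p u)) (phi u (l u) (p u)).
  move=> /familyP pv; rewrite -prodrXl -prodf_div; apply: eq_bigr => u _.
  by rewrite phi_id//; exact: pv.
have K0 : 0 <= N ^+ 2 * \prod_u kappa u (l u).
  by rewrite mulr_ge0 ?sqr_ge0// prodr_ge0.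
(* The last factor on the left is 1 for an empty box. Otherwise it is at most 0, and the right side
   is nonnegative. *)
have term_ge (p : {ffun 'I_n -> 'I_Q}) : p \in valid ->
    N ^+ 2 * \prod_u kappa u (l u) * (1 - \sum_(z <- P) (box p z)%:R) <=
    (\sum_(z <- P) \prod_u inner \1_`]tnth z u, 1[ (phi u (l u) (p u))
     - N * \prod_u inner id (phi u (l u) (p u))) ^+ 2
    / \prod_u inner (phi u (l u) (p u)) (phi u (l u) (p u)).
  move=> pv.
  have norm_ge0 : 0 <= \prod_u inner (phi u (l u) (p u)) (phi u (l u) (p u)).
    by apply: prodr_ge0 => u _; apply/ltW/phi_norm; move/familyP: pv; exact.
  have [/hasP[z zP zp]|/hasPn nz] := boolP (has (box p) P).
    rewrite (@le_trans _ _ 0)//; last by rewrite divr_ge0 ?sqr_ge0.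
    apply: mulr_ge0_le0 => //.
    by rewrite subr_le0 (big_rem z)//= zp lerDl sumr_ge0.
  have -> : \sum_(z <- P) (box p z)%:R = 0 :> R.
    by rewrite big_seq big1// => z zP; rewrite (negbTE (nz z zP)).
  have -> : \sum_(z <- P) \prod_u inner \1_`]tnth z u, 1[ (phi u (l u) (p u)) = 0.
    rewrite big_seq big1// => z zP.
    have [u zu] : exists u, ~ supp u (l u) (p u) (tnth z u).
      by apply/existsNP => zp; move/negP: (nz z zP); apply; exact/asboolP.
    rewrite (bigD1 u)//= phi_indic ?mul0r//; first by move/familyP: pv; exact.
    exact: P01.
  by rewrite subr0 mulr1 sub0r sqrrN (kappaE _ pv) exprMn mulrA.
apply: (@le_trans _ _ (\sum_(p in valid)
    N ^+ 2 * \prod_u kappa u (l u) * (1 - \sum_(z <- P) (box p z)%:R))); last first.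
  exact: ler_sum.
rewrite -mulr_sumr sumrB sum_valid exchange_big/=.
rewrite ler_wpM2l// lerB// NE; apply: ler_sum => z _; exact: sum_box.
Qed.

End one_level.

(** A level vector with fewer boxes than points gives only the trivial bound 0, whence
    [Num.max 0]. *)
Lemma levels_sum_le (J : nat) :
  \sum_(l : n.-tuple 'I_J) N ^+ 2 * \prod_u kappa u (tnth l u) *
    Num.max 0 (\prod_u (cnt u (tnth l u))%:R - N) <=
  \int[tuple_lebesgue_measure R n]_(x in @unit_cube R n) discrepancy P x ^+ 2.
Proof.
(* A bound on the number of positions at all levels below [J], which makes the whole index set
   finite. *)
pose Q := (\max_(u < n) \max_(j < J) cnt u j)%N.
pose valid (l : n.-tuple 'I_J) :=
  family (fun u => [pred j : 'I_Q | (j < cnt u (tnth l u))%N]).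
pose psi (a : n.-tuple 'I_J * {ffun 'I_n -> 'I_Q}) u := phi u (tnth a.1 u) (a.2 u).
apply: le_trans (@discrepancy_bessel R n P _ (fun a => a.2 \in valid a.1) psi _ _ _).
- rewrite -(pair_big_dep xpredT (fun l p => p \in valid l) (fun l p =>
    (\sum_(z <- P) \prod_u inner \1_`]tnth z u, 1[ (psi (l, p) u)
     - N * \prod_u inner id (psi (l, p) u)) ^+ 2
    / \prod_u inner (psi (l, p) u) (psi (l, p) u)))/=.
  apply: ler_sum => l _.
  have cntQ u : (cnt u (tnth l u) <= Q)%N.
    rewrite (leq_trans _ (leq_bigmax u))//.
    exact: (leq_bigmax (tnth l u)).
  have [_|_] := leP 0 (\prod_u (cnt u (tnth l u))%:R - N).
    exact: (@empty_boxes_sum Q (fun u => tnth l u)).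
  rewrite mulr0; apply: sumr_ge0 => p /familyP pv.
  rewrite divr_ge0 ?sqr_ge0//; apply: prodr_ge0 => u _; apply/ltW/phi_norm.
  exact: pv.
- by move=> a u; exact: phi_bounded.
- move=> [l p] [l' p'] /= /familyP pv /familyP pv' ll'.
  (* Distinct indices differ in level or position in some coordinate, and there the inner product
     vanishes. *)
  have [u /eqP lpu] : exists u,
      (tnth l u : nat, p u : nat) <> (tnth l' u : nat, p' u : nat).
    apply/existsNP => E; move/eqP: ll'; apply.
    congr pair; [apply: eq_from_tnth|apply/ffunP] => u; apply: val_inj;
      by have [] := E u.
  by exists u; apply: phi_orth => //; [exact: pv|exact: pv'].
- by move=> [l p] u /= /familyP pv; apply: phi_norm; exact: pv.
Qed.

End wavelet_systems.

(** * Counting level vectors by the sum of their entries *)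

Section count_levels.
Local Open Scope nat_scope.

(** Stars and bars: entries with sum [m] are at most [m], so for [m < J] all these tuples fit into
    ['I_J]. *)
Lemma binomial_le_card_tuple_sum k J m : m < J ->
  'C(m + k, k) <= #|[pred t : k.+1.-tuple 'I_J | \sum_(i <- t) (i : nat) == m]|.
Proof.
move=> mJ; rewrite addnC -(card_ord_partitions k m).
pose w (t : k.+1.-tuple 'I_m.+1) : k.+1.-tuple 'I_J := [tuple of map (widen_ord mJ) t].
have w_inj : injective w.
  move=> s t /(congr1 val)/= /inj_map st; apply: val_inj; apply: st.
  by move=> i j /(congr1 val)/= ij; exact: val_inj.
rewrite -(card_imset _ w_inj); apply/subset_leq_card/fintype.subsetP => _ /imsetP[t + ->].
by rewrite !inE big_map.
Qed.

End count_levels.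

Section sum_levels.
Variables (R : realType) (k J : nat) (f : nat -> nat -> R).
Hypothesis f_ge0 : forall i m, 0 <= f i m.

(** The estimates depend on the last [k.+1] levels only through their sum. Tuples for which this sum
    is [J] or more are dropped. *)
Lemma sum_levels_ge :
  \sum_(i < J) \sum_(m < J) 'C(m + k, k)%:R * f i m <=
  \sum_(t : k.+2.-tuple 'I_J)
    f (tnth t ord0) (\sum_(u < k.+1) tnth t (lift ord0 u))%N.
Proof.
pose h (x : 'I_J * k.+1.-tuple 'I_J) : k.+2.-tuple 'I_J := [tuple of x.1 :: x.2].
pose h' (t : k.+2.-tuple 'I_J) : 'I_J * k.+1.-tuple 'I_J :=
  (thead t, [tuple of behead t]).
rewrite (reindex h); last first.
  exists h' => [[x t] _|t _]; first by rewrite /h' theadE; congr pair; exact: val_inj.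
  by rewrite /h [RHS]tuple_eta.
rewrite -(pair_big xpredT xpredT (fun i t => f (tnth (h (i, t)) ord0)
  (\sum_(u < k.+1) tnth (h (i, t)) (lift ord0 u))%N))/=.
apply: ler_sum => i _.
pose s (t : k.+1.-tuple 'I_J) := (\sum_(i <- t) (i : nat))%N.
have E t : f (tnth (h (i, t)) ord0) (\sum_(u < k.+1) tnth (h (i, t)) (lift ord0 u))%N
    = f i (s t).
  rewrite tnth0; congr f; rewrite /s big_tuple.
  by apply: eq_bigr => u _; rewrite tnthS.
under [leRHS]eq_bigr do rewrite E.
apply: (@le_trans _ _ (\sum_t \sum_(m < J | s t == m) f i m)); last first.
  apply: ler_sum => t _; have [stJ|Jst] := ltnP (s t) J.
    by rewrite (big_pred1 (Ordinal stJ)).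
  by rewrite big_pred0// => m; apply/negbTE; rewrite gtn_eqF// (leq_trans _ Jst).
rewrite (exchange_big_dep xpredT)//=; apply: ler_sum => m _.
rewrite sumr_const -[leRHS]mulr_natl ler_wpM2r// ler_nat.
exact: binomial_le_card_tuple_sum.
Qed.

End sum_levels.

(** * The Haar system with a rescaled grid in the first coordinate *)

Section haar_lower_bound.
Variables (R : realType) (k : nat) (P : {fset k.+2.-tuple R}).
Hypothesis P01 : forall z : k.+2.-tuple R, z \in P -> unit_cube z.
Variables (c : R) (q : nat -> nat).
Hypothesis c0 : 0 < c.
Hypothesis q1 : forall i, (q i)%:R * (c * 2 ^- i) <= 1.

Let N : R := #|` P|%:R.

(* The first coordinate carries the constant function (level 0) and the Haar
   functions on the grids of step [c * 2 ^- i] (level [i.+1]). *)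
Let phi0 l p : R -> R := if l is i.+1 then haar_level c i p else cst 1.
Let cnt0 l : nat := if l is i.+1 then q i else 1%N.
(** For support length [h] the identity has coefficient [- (h / 2) ^+ 2] and the squared norm is
    [h], which gives [h ^+ 3 / 16]; for the constant function it is [(1 / 2) ^+ 2 / 1]. *)
Let kappa0 l : R := if l is i.+1 then (c * 2 ^- i) ^+ 3 / 16 else 1 / 4.
(** Level 0 has the single position 0, supported everywhere; the empty set at other [p] keeps the
    position determined by the point. *)
Let supp0 l p : set R := if l is i.+1 then cell (c * 2 ^- i) p else [set _ | p = 0%N].

Let phi (u : 'I_k.+2) l p := if u == ord0 then phi0 l p else haar_level 1 l p.
Let cnt (u : 'I_k.+2) l := if u == ord0 then cnt0 l else (2 ^ l)%N.
Let kappa (u : 'I_k.+2) l : R :=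
  if u == ord0 then kappa0 l else (1 * 2 ^- l) ^+ 3 / 16.
Let supp (u : 'I_k.+2) l p : set R :=
  if u == ord0 then supp0 l p else cell (1 * 2 ^- l) p.

Lemma lt_count_le1 (b : R) i (r p : nat) : 0 < b ->
  r%:R * (b * 2 ^- i) <= 1 -> (p < r)%N -> p.+1%:R * (b * 2 ^- i) <= 1.
Proof.
move=> b0 r1 pr; apply: le_trans r1.
by rewrite ler_wpM2r ?ler_nat// mulr_ge0 ?invr_ge0 ?exprn_ge0// ltW.
Qed.

Let dyadic1 i : (2 ^ i)%:R * (1 * 2 ^- i) <= 1 :> R.
Proof. by rewrite mul1r natrX divff// expf_neq0. Qed.

Let w0 (b : R) i : 0 < b -> 0 < b * 2 ^- i.
Proof. by move=> b0; rewrite mulr_gt0// invr_gt0 exprn_gt0. Qed.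

Let wE (b : R) i : b * 2 ^- i.+1 * 2 = b * 2 ^- i.
Proof. by rewrite exprSr invfM; field; rewrite expf_neq0. Qed.

Let wl (b : R) i p : p.+1%:R * (b * 2 ^- i) <= 1 ->
  p.+1%:R * (b * 2 ^- i.+1 * 2) <= 1.
Proof. by rewrite wE. Qed.

Let haar_norm (b : R) i p : 0 < b -> p.+1%:R * (b * 2 ^- i) <= 1 ->
  inner (haar_level b i p) (haar_level b i p) = b * 2 ^- i.
Proof. by move=> b0 /wl b1; rewrite (inner_haar_haar (w0 _ b0) b1) wE. Qed.

Let haar_kappa (b : R) i p : 0 < b -> p.+1%:R * (b * 2 ^- i) <= 1 ->
  inner id (haar_level b i p) ^+ 2 / inner (haar_level b i p) (haar_level b i p)
  = (b * 2 ^- i) ^+ 3 / 16.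
Proof.
move=> b0 b1; rewrite haar_norm// (inner_id_haar (w0 _ b0) (wl b1)).
rewrite -[in RHS]wE -[in X in _ / X = _]wE.
have : b * 2 ^- i.+1 != 0 by rewrite gt_eqF// w0.
by move: (b * _) => w wn; field.
Qed.

Let haar_indic (b : R) i p z : 0 < b -> p.+1%:R * (b * 2 ^- i) <= 1 ->
  0 <= z < 1 -> ~ cell (b * 2 ^- i) p z -> inner \1_`]z, 1[ (haar_level b i p) = 0.
Proof.
move=> b0 b1 z01 zp; apply: (inner_indic_haar (w0 _ b0) (wl b1) z01).
by rewrite wE.
Qed.

Let unit_bounded_cst1 : unit_bounded (cst 1 : R -> R).
Proof. by split => [|x _]; [exact: measurable_cst|rewrite normr1]. Qed.

Let inner_one : inner (cst 1) (cst 1) = 1 :> R.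
Proof.
rewrite /inner (@Rintegral_itv_cst _ _ 1)//; first by rewrite subr0 mulr1.
by move=> x _; rewrite /= mulr1.
Qed.

Let inner_id_one : inner id (cst 1) = 1 / 2 :> R.
Proof.
transitivity (\int[@lebesgue_measure R]_(x in `[0, 1[) (x : R)).
  by apply: eq_Rintegral => x _; rewrite /= mulr1.
by rewrite Rintegral_itv_id//; field.
Qed.

Lemma haar_lower_bound J :
  \sum_(l < J) \sum_(m < J) 'C(m + k, k)%:R *
    (N ^+ 2 * (kappa0 l * ((2 ^- m) ^+ 3 / 16 ^+ k.+1)) *
     Num.max 0 ((cnt0 l)%:R * 2 ^+ m - N)) <=
  \int[tuple_lebesgue_measure R k.+2]_(x in @unit_cube R k.+2) discrepancy P x ^+ 2.
Proof.
have kappa0_ge0 l : 0 <= kappa0 l.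
  by case: l => [|i] /=; rewrite divr_ge0// exprn_ge0// ltW// w0.
apply: (@le_trans _ _ (\sum_(t : k.+2.-tuple 'I_J)
    N ^+ 2 * \prod_u kappa u (tnth t u) *
    Num.max 0 (\prod_u (cnt u (tnth t u))%:R - N))).
  apply: le_trans (@sum_levels_ge R k J (fun l m =>
    N ^+ 2 * (kappa0 l * ((2 ^- m) ^+ 3 / 16 ^+ k.+1)) *
     Num.max 0 ((cnt0 l)%:R * 2 ^+ m - N)) _) _.
    move=> l m; rewrite mulr_ge0 ?le_max ?lexx//.
    have m0 : 0 <= 2 ^- m :> R by rewrite invr_ge0 exprn_ge0.
    by rewrite mulr_ge0 ?sqr_ge0// mulr_ge0// divr_ge0 ?exprn_ge0.
  rewrite le_eqVlt; apply/orP; left; apply/eqP; apply: eq_bigr => t _.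
  set m := (\sum_(u < k.+1) _)%N.
  rewrite [\prod_u kappa u _]big_ord_recl [\prod_u (cnt u _)%:R]big_ord_recl.
  rewrite /kappa /cnt /=.
  have -> : \prod_(u < k.+1) ((1 * 2 ^- tnth t (lift ord0 u)) ^+ 3 / 16) =
      (2 ^- m) ^+ 3 / 16 ^+ k.+1 :> R.
    rewrite prodf_div prodr_const card_ord prodrXl; congr (_ ^+ 3 / _).
    under eq_bigr do rewrite mul1r; rewrite prodfV /m.
    by congr (_^-1); rewrite (big_morph _ (exprD 2) (expr0 2)).
  have -> : \prod_(u < k.+1) (2 ^ tnth t (lift ord0 u))%:R = 2 ^+ m :> R.
    by rewrite /m -[RHS]natrX expn_sum natr_prod.
  by [].
have q0 i p : (p < q i)%N -> p.+1%:R * (c * 2 ^- i) <= 1.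
  by apply: lt_count_le1.
have d0 i p : (p < 2 ^ i)%N -> p.+1%:R * (1 * 2 ^- i) <= 1 :> R.
  by apply: lt_count_le1.
apply: (@levels_sum_le R k.+2 P P01 phi supp cnt kappa).
- move=> u l p; rewrite /phi; case: eqP => _.
    by case: l => [|i] //=; apply: unit_bounded_haar; exact: w0.
  by apply: unit_bounded_haar; exact: w0.
- move=> u l p l' p'; rewrite /phi /cnt; case: eqP => _.
    case: l l' => [|i] [|i'] /=.
    + by rewrite !ltnS !leqn0 => /eqP -> /eqP ->; rewrite eqxx.
    + move=> _ p'q _.
      by apply: (inner_haar_cst (w0 _ c0) (wl (q0 _ _ p'q)) (v := 1)).
    + move=> pq _ _; rewrite innerC.
      by apply: (inner_haar_cst (w0 _ c0) (wl (q0 _ _ pq)) (v := 1)).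
    + by move=> pq p'q lp; apply: inner_haar_level => //; exact: q0.
  by move=> pq p'q lp; apply: inner_haar_level => //; exact: d0.
- move=> u l p; rewrite /phi /cnt; case: eqP => _.
    case: l => [|i] /= pq; first by rewrite inner_one.
    by rewrite haar_norm ?w0//; exact: q0.
  by move=> pq; rewrite haar_norm ?w0//; exact: d0.
- move=> u l p; rewrite /phi /cnt /kappa; case: eqP => _.
    case: l => [|i] /= pq; first by rewrite inner_one inner_id_one; field.
    by rewrite haar_kappa//; exact: q0.
  by move=> pq; rewrite haar_kappa//; exact: d0.
- move=> u l; rewrite /kappa; case: eqP => _; first exact: kappa0_ge0.
  by apply: divr_ge0 => //; apply/exprn_ge0/ltW/w0.
- move=> u l p z; rewrite /phi /cnt /supp; case: eqP => _.
    case: l => [|i] /=; first by rewrite ltnS leqn0 => /eqP ->.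
    by move=> pq z01; apply: haar_indic => //; exact: q0.
  by move=> pq z01; apply: haar_indic => //; exact: d0.
- move=> u l p p' z; rewrite /supp; case: eqP => _.
    case: l => [|i] /=; first by move=> -> ->.
    by apply: cell_inj; exact: w0.
  by apply: cell_inj; exact: w0.
Qed.

End haar_lower_bound.

(** * Summation over the levels *)

Lemma hockey_stick n k :
  (\sum_(i < n.+1) 'C(n - i + k, k) = 'C(n + k.+1, k.+1))%N.
Proof.
rewrite (reindex_inj rev_ord_inj)/=.
have -> : (\sum_(i < n.+1) 'C(n - (n.+1 - i.+1) + k, k) =
           \sum_(i < n.+1) 'C(i + k, k))%N.
  by apply: eq_bigr => i _; rewrite subSS subKn// -ltnS.
elim: n => [|n IH]; first by rewrite big_ord1 !add0n !binn.
by rewrite big_ord_recr/= IH addSnnS [in RHS]addSn binS.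
Qed.

(** The right side is the product [(m + 1) ... (m + k)], whose factors are all at least [m.+1]. *)
Lemma exp_le_binomial_fact m k : ((m.+1) ^ k <= 'C(m + k, k) * k`!)%N.
Proof.
elim: k => [|k IH]; first by rewrite bin0.
have : ('C(m + k.+1, k.+1) * k.+1 = (m + k).+1 * 'C(m + k, k))%N.
  by rewrite addnS mulnC -mul_bin_diag.
rewrite factS mulnA => ->; rewrite expnS -mulnA leq_mul//.
by rewrite ltnS leq_addr.
Qed.

Section selected_levels.
Variables (R : numDomainType) (F : nat -> nat -> R).
Hypothesis F0 : forall i m, 0 <= F i m.

(** The antidiagonals [i + m = M + e] are disjoint; along each of them the box volume will be
    constant. *)
Lemma sum_antidiagonals_le M K I J : (M + K <= I)%N -> (M + K <= J)%N ->
  \sum_(e < K) \sum_(i < (M + e).+1) F i (M + e - i) <=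
  \sum_(i < I) \sum_(m < J) F i m.
Proof.
move=> MI MJ.
apply: (@le_trans _ _
    (\sum_(e < K) \sum_(i < I) \sum_(m < J | (i + m == M + e)%N) F i m)).
  apply: ler_sum => e _.
  have eI : ((M + e).+1 <= I)%N by rewrite (leq_trans _ MI)// -addnS leq_add2l.
  rewrite (big_ord_widen I (fun i => F i (M + e - i)%N) eI) big_mkcond/=.
  apply: ler_sum => i _; case: ifPn => [ie|_]; last by rewrite sumr_ge0.
  have mJ : (M + e - i < J)%N.
    by rewrite (leq_ltn_trans (leq_subr _ _))// (leq_trans _ MJ)// ltn_add2l.
  rewrite (big_pred1 (Ordinal mJ))// => m /=.
  by rewrite -val_eqE/=; lia.
rewrite exchange_big; apply: ler_sum => i _.
rewrite (exchange_big_dep xpredT)//=; apply: ler_sum => m _.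
have [[e E]|nE] := pselect (exists e : 'I_K, (i + m == M + e)%N).
  rewrite (big_pred1 e)// => e' /=; apply/idP/eqP => [E'|->//].
  by apply: val_inj; move: E E' => /=; lia.
rewrite big_pred0// => e; apply/negbTE/negP => E; apply: nE; by exists e.
Qed.

Lemma sum_shift_le (G : nat -> R) A K J : (forall m, 0 <= G m) -> (A + K <= J)%N ->
  \sum_(e < K) G (A + e)%N <= \sum_(m < J) G m.
Proof.
move=> G0 AJ; rewrite -(big_mkord xpredT G) (@big_cat_nat _ _ _ A)//=; last first.
  by rewrite (leq_trans _ AJ)// leq_addr.
rewrite -[X in X <= _]add0r lerD ?sumr_ge0// (@big_cat_nat _ _ _ (A + K))//=; last first.
  by rewrite leq_addr.
rewrite -[X in X <= _]addr0 lerD ?sumr_ge0//.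
by rewrite -{2}[A]add0n big_addn addKn big_mkord le_eqVlt; apply/orP; left;
  apply/eqP; apply: eq_bigr => e _; rewrite addnC.
Qed.

End selected_levels.

Section level_sums.
Variable R : realType.
(** [gamma i] will be the length of the part of [[0, 1[] covered by full cells of length
    [c * 2 ^- i]. *)
Variables (c : R) (gamma : nat -> R).
Hypotheses (c1 : c <= 1) (c12 : 1 / 2 <= c).
Hypotheses (gamma_le1 : forall i, gamma i <= 1)
  (gamma_ge : forall i, 1 - c * 2 ^- i <= gamma i)
  (gamma0 : c <= gamma 0) (gamma1 : c <= gamma 1).

(** Levels 0 and 1 lose at most [1 - c] each and level [i >= 2] at most [c * 2 ^- i]: in total
    [2 * (1 - c) + c / 2]. *)
Lemma uncovered_sum_le n : \sum_(i < n.+1) (1 - gamma i) <= 2 - 3 / 2 * c.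
Proof.
case: n => [|n]; first by rewrite big_ord1; move: gamma0 c1; lra.
(* For the induction, the bound is lowered by the geometric tail [c * 2 ^- n.+1] of the later
   levels. *)
apply: (@le_trans _ _ (2 - 3 / 2 * c - c * 2 ^- n.+1)); last first.
  rewrite lerBlDr lerDl mulr_ge0// ?invr_ge0 ?exprn_ge0//.
  by move: c12; lra.
elim: n => [|n IH].
  by rewrite !big_ord_recr big_ord0/= expr1; move: gamma0 gamma1; lra.
rewrite big_ord_recr/=; move: IH (gamma_ge n.+2) => /=.
have -> : c * 2 ^- n.+1 = 2 * (c * 2 ^- n.+2).
  by rewrite [in RHS]exprSr invfM; field; rewrite expf_neq0.
move: (\sum_(i < _) _) (c * _) (gamma _) => s h g; lra.
Qed.

Variable M k : nat.

(** [N] times the volume of the boxes on the antidiagonal [M + e]. *)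
Let t (e : nat) : R := 7 / 9 * 2 ^- e.

(* Gain from the functions constant in the first coordinate minus the bound of
   [uncovered_sum_le] on the loss; only [sigma 0] can be negative. *)
Let sigma e : R := c ^- 2 * (1 - t e / (2 * c)) - (2 - 3 / 2 * c).

Let t_le e : t e <= 7 / 9.
Proof.
rewrite /t ler_piMr// invf_le1 ?exprn_gt0// exprn_ege1//; lra.
Qed.

Let t_le' e : t e.+1 <= 7 / 18.
Proof.
have := t_le e; rewrite /t exprSr invfM.
by move: (2 ^- e) => y; lra.
Qed.

(** Squares and cubes form geometric series of ratios [1 / 4] and [1 / 8]; the limit is [4 / 3 * (7
    / 9) ^+ 2 - 8 / 7 * (7 / 9) ^+ 3]. *)
Lemma geometric_sum_ge K :
  196 / 729 - 4 ^- K <= \sum_(e < K) t e ^+ 2 * (1 - t e).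
Proof.
have -> : \sum_(e < K) t e ^+ 2 * (1 - t e) =
    196 / 243 * (1 - 4 ^- K) - 392 / 729 * (1 - 8 ^- K).
  elim: K => [|K IH]; first by rewrite big_ord0 !expr0 !invr1; field.
  rewrite big_ord_recr/= IH /t.
  have -> : 4 ^+ K.+1 = 4 * (2 ^+ K) ^+ 2 :> R.
    by rewrite exprS -exprM mulnC exprM; congr (_ * _ ^+ _); ring.
  have -> : 8 ^+ K.+1 = 8 * (2 ^+ K) ^+ 3 :> R.
    by rewrite exprS -exprM mulnC exprM; congr (_ * _ ^+ _); ring.
  have -> : 4 ^+ K = (2 ^+ K) ^+ 2 :> R.
    by rewrite -exprM mulnC exprM; congr (_ ^+ _); ring.
  have -> : 8 ^+ K = (2 ^+ K) ^+ 3 :> R.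
    by rewrite -exprM mulnC exprM; congr (_ ^+ _); ring.
  by field; rewrite expf_neq0.
have : 0 <= 8 ^- K :> R by rewrite invr_ge0 exprn_ge0.
have : 0 <= 4 ^- K :> R by rewrite invr_ge0 exprn_ge0.
by move: (4 ^- K) (8 ^- K) => x y; lra.
Qed.

Let c0 : 0 < c. Proof. by move: c12; lra. Qed.

(** Equality holds at [c = 1 / 2]; the Taylor expansion there has a nonnegative remainder for
    [u >= 0], after completing a square. *)
Let poly_ge : 11 / 32 <= c - 2 * c ^+ 3 + 3 / 2 * c ^+ 4.
Proof.
pose u := c - 1 / 2.
have u0 : 0 <= u by rewrite /u; move: c12; lra.
have -> : c - 2 * c ^+ 3 + 3 / 2 * c ^+ 4 =
    11 / 32 + u * ((u - 3 / 8) ^+ 2 + 7 / 64) + u ^+ 3 * (3 / 2 * u).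
  by rewrite /u; field.
rewrite -addrA lerDl addr_ge0//; last by rewrite !mulr_ge0// exprn_ge0.
by rewrite mulr_ge0// addr_ge0 ?sqr_ge0.
Qed.

Let sigmaE e : sigma e = c ^- 3 * (c - 2 * c ^+ 3 + 3 / 2 * c ^+ 4 - t e / 2).
Proof. by rewrite /sigma; field; rewrite gt_eqF. Qed.

Let sigma_ge0 e : 0 <= sigma e.+1.
Proof.
rewrite sigmaE mulr_ge0 ?invr_ge0 ?exprn_ge0 ?(ltW c0)//.
move: poly_ge (t_le' e); move: (t e.+1) (c - _ + _) => x A; lra.
Qed.

Let C_le e n : (e <= n)%N -> 'C(e + k, k)%:R <= 'C(n + k, k)%:R :> R.
Proof. by move=> en; rewrite ler_nat leq_bin2l// leq_add2r. Qed.

(** The terms [e = 1] and [e = 2] outweigh a negative term [e = 0]. Lowering their binomials to that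
    of [e = 0] only decreases them, since [sigma] is nonnegative there. *)
Lemma surplus_sum_ge0 K : (3 <= K)%N ->
  0 <= \sum_(e < K) 'C(M + e + k, k)%:R * (t e ^+ 2 * sigma e).
Proof.
case: K => [|[|[|K]]]// _; rewrite !big_ord_recl/= /bump/= !addn0 !addn1.
have f_ge e : 'C(M + k, k)%:R * (t e.+1 ^+ 2 * sigma e.+1) <=
    'C(M + e.+1 + k, k)%:R * (t e.+1 ^+ 2 * sigma e.+1).
  by rewrite ler_wpM2r ?C_le ?leq_addr// mulr_ge0 ?sqr_ge0.
have r_ge0 : 0 <= \sum_(i < K)
    'C(M + (1 + (1 + (1 + i))) + k, k)%:R *
    (t (1 + (1 + (1 + i))) ^+ 2 * sigma (1 + (1 + (1 + i)))).
  by apply: sumr_ge0 => i _; rewrite mulr_ge0// mulr_ge0 ?sqr_ge0.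
have h : 0 <= 'C(M + k, k)%:R * (t 0 ^+ 2 * sigma 0) +
    'C(M + k, k)%:R * (t 1 ^+ 2 * sigma 1) + 'C(M + k, k)%:R * (t 2 ^+ 2 * sigma 2).
  rewrite -2!mulrDr mulr_ge0// !sigmaE.
  set A := c - _ + _; have : 11 / 32 <= A by exact: poly_ge.
  have -> : t 0 = 7 / 9 by rewrite /t expr0 invr1 mulr1.
  have -> : t 1 = 7 / 18 by rewrite /t expr1; field.
  have -> : t 2 = 7 / 36 by rewrite /t; field.
  move=> hA.
  (* [21 / 16 = 1 + 1 / 4 + 1 / 16] and [73 / 64 = 1 + 1 / 8 + 1 / 64]. At [A = 11 / 32] the first
     two terms alone would be negative, whence [3 <= K]. *)
  have -> : (7 / 9) ^+ 2 * (c ^- 3 * (A - 7 / 9 / 2)) +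
      (7 / 18) ^+ 2 * (c ^- 3 * (A - 7 / 18 / 2)) +
      (7 / 36) ^+ 2 * (c ^- 3 * (A - 7 / 36 / 2)) =
      c ^- 3 * (49 / 81 * (21 / 16) * A - 343 / 729 * (73 / 64) / 2).
    by field; rewrite gt_eqF.
  apply: mulr_ge0; first by rewrite invr_ge0 exprn_ge0// ltW.
  by move: (A) hA => x; lra.
apply: (le_trans h); rewrite -addrA lerD2l; apply: lerD.
  by have := f_ge 0; rewrite addn1.
by apply: le_trans (f_ge 1) _; rewrite lerDl.
Qed.

(** Write [gamma i - t e] as [(1 - t e) - (1 - gamma i)]. The first part sums by the hockey-stick
    identity, the second is the loss on the uncovered part, and the second sum on the right, from
    the constant functions, makes up for it. *)
Lemma level_sums_ge K : (3 <= K)%N ->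
  (196 / 729 - 4 ^- K) * 'C(M + k.+1, k.+1)%:R <=
  \sum_(e < K) \sum_(i < (M + e).+1)
     'C(M + e - i + k, k)%:R * (t e ^+ 2 * (gamma i - t e)) +
  \sum_(e < K) 'C(M.+1 + e + k, k)%:R *
     (4 * (t e / (2 * c)) ^+ 2 * (1 - t e / (2 * c))).
Proof.
move=> K3.
apply: (@le_trans _ _ (\sum_(e < K) (t e ^+ 2 * (1 - t e) * 'C(M + k.+1, k.+1)%:R +
    'C(M + e + k, k)%:R * (t e ^+ 2 * sigma e)))).
  rewrite big_split/= -mulr_suml -[X in X <= _]addr0 lerD ?surplus_sum_ge0//.
  by rewrite ler_wpM2r ?geometric_sum_ge.
rewrite -big_split/=; apply: ler_sum => e _; set n := (M + e)%N.
have t2 : 0 <= t e ^+ 2 by exact: sqr_ge0.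
have t1 : 0 <= 1 - t e by move: (t_le e); lra.
have s1 : 0 <= 1 - t e / (2 * c).
  rewrite subr_ge0 ler_pdivrMr ?mul1r ?mulr_gt0//.
  by move: (t_le e) c12; lra.
have -> : \sum_(i < n.+1) 'C(n - i + k, k)%:R * (t e ^+ 2 * (gamma i - t e)) =
    t e ^+ 2 * ((1 - t e) * 'C(n + k.+1, k.+1)%:R
                - \sum_(i < n.+1) 'C(n - i + k, k)%:R * (1 - gamma i)).
  rewrite -hockey_stick natr_sum mulr_sumr -sumrB mulr_sumr.
  by apply: eq_bigr => i _; ring.
have loss : \sum_(i < n.+1) 'C(n - i + k, k)%:R * (1 - gamma i) <=
    'C(n + k, k)%:R * (2 - 3 / 2 * c).
  apply: (@le_trans _ _ ('C(n + k, k)%:R * \sum_(i < n.+1) (1 - gamma i))).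
    rewrite mulr_sumr; apply: ler_sum => i _.
    by rewrite ler_wpM2r ?subr_ge0// C_le// leq_subr.
  by rewrite ler_wpM2l// uncovered_sum_le.
have main : (1 - t e) * 'C(M + k.+1, k.+1)%:R <= (1 - t e) * 'C(n + k.+1, k.+1)%:R.
  by rewrite ler_wpM2l// ler_nat leq_bin2l// leq_add2r leq_addr.
have father : 'C(n + k, k)%:R * (t e ^+ 2 * (c ^- 2 * (1 - t e / (2 * c)))) <=
    'C(M.+1 + e + k, k)%:R * (4 * (t e / (2 * c)) ^+ 2 * (1 - t e / (2 * c))).
  have -> : 4 * (t e / (2 * c)) ^+ 2 = t e ^+ 2 * c ^- 2.
    by field; rewrite gt_eqF.
  rewrite -mulrA ler_wpM2r//; last by rewrite C_le// /n leq_add2r.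
  by rewrite mulr_ge0// mulr_ge0// invr_ge0 exprn_ge0// ltW.
apply: le_trans (lerD (ler_wpM2l t2 (lerB main loss)) father).
by rewrite /sigma le_eqVlt; apply/orP; left; apply/eqP; ring.
Qed.

End level_sums.

(** * Choice of the parameters *)

(** Passage to the limit in [K], with an explicit [K] for each margin [e]. *)
Lemma ler_of_geometric_error (R : archiRealFieldType) (a x y : R) : 0 <= y ->
  (forall K, (3 <= K)%N -> (a - 4 ^- K) * y <= x) -> a * y <= x.
Proof.
move=> y0 H; apply/ler_addgt0Pr => e e0.
pose K := (Num.trunc (y / e)).+3.
have yK : y <= e * 4 ^+ K.
  rewrite mulrC -ler_pdivrMr//.
  have /andP[_ h] := truncn_itv (divr_ge0 y0 (ltW e0)).
  apply/(le_trans (ltW h)); rewrite -natrX ler_nat.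
  apply: leq_trans (ltnW (ltn_expl K (isT : 1 < 4)%N)).
  exact: leqW (leqW (leqnn _)).
have := H K isT; rewrite mulrBl lerBlDr => h; apply: (le_trans h).
rewrite lerD2l mulrC ler_pdivrMr ?exprn_gt0//.
Qed.

Lemma discrepancy_sqr_ge (R : realType) (k : nat) (P : {fset k.+2.-tuple R}) :
  (forall z : k.+2.-tuple R, z \in P -> unit_cube z) -> (0 < #|` P|)%N ->
  exists2 M, (#|` P| <= 2 ^ M.+1)%N &
  196 / 729 * (M.+1%:R ^+ k.+1 / (k.+1)`!%:R) <= 16 ^+ k.+2 *
  \int[tuple_lebesgue_measure R k.+2]_(x in @unit_cube R k.+2) discrepancy P x ^+ 2.
Proof.
move=> P01; move nE : (#|` P|)%fset => n n0.
(* The largest [M] with [7 * 2 ^ M <= 9 * n]: then [c] below lies between [1 / 2] and 1, and boxes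
   of volume [c * 2 ^- M] have [N] times volume equal to [7 / 9]. *)
pose M := trunc_log 2 (9 * n %/ 7).
have /andP[M1 M2] : (7 * 2 ^ M <= 9 * n < 7 * 2 ^ M.+1)%N.
  have n79 : (0 < 9 * n %/ 7)%N by rewrite divn_gt0//; lia.
  have /andP[h1 h2] := trunc_log_bounds (isT : 1 < 2)%N n79.
  rewrite -/M in h1 h2; apply/andP; split.
    by rewrite mulnC; apply: leq_trans (leq_divM (9 * n) 7); rewrite leq_mul2r h1.
  by rewrite [ltnRHS]mulnC -ltn_divLR.
exists M; first by lia.
pose N : R := n%:R.
have N0 : 0 < N by rewrite ltr0n.
pose c : R := 7 / 9 * 2 ^+ M / N.
have cN : N * c = 7 / 9 * 2 ^+ M by rewrite /c; field; rewrite gt_eqF.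
have M1R : 7 * 2 ^+ M <= 9 * N.
  by rewrite -natrX -!natrM ler_nat.
have M2R : 9 * N <= 14 * 2 ^+ M.
  by rewrite -natrX -!natrM ler_nat (leq_trans (ltnW M2))// expnS mulnA.
have c0 : 0 < c by rewrite /c divr_gt0// mulr_gt0// exprn_gt0.
have c1 : c <= 1 by rewrite /c ler_pdivrMr//; move: M1R; lra.
have c12 : 1 / 2 <= c by rewrite /c ler_pdivlMr//; move: M2R; lra.
pose h i : R := c * 2 ^- i.
have h0 i : 0 < h i by rewrite mulr_gt0// invr_gt0 exprn_gt0.
(* The largest number of cells of length [h i] that fit into the unit interval. *)
pose q i := Num.trunc (h i)^-1.
have q_itv i : (q i)%:R * h i <= 1 /\ 1 < (q i).+1%:R * h i.
  have /andP[q1 q2] := truncn_itv (ltW (etrans (invr_gt0 _) (h0 i))).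
  by rewrite -ler_pdivlMr// div1r q1 -ltr_pdivrMr// div1r q2.
have q_ge i j : j%:R * h i <= 1 -> (j <= q i)%N.
  move=> jh; rewrite -ltnS -(ltr_nat R) -(ltr_pM2r (h0 i)).
  exact: le_lt_trans jh (q_itv i).2.
pose gamma i : R := (q i)%:R * h i.
have gamma_ge j i : j%:R * h i <= 1 -> j%:R * h i <= gamma i.
  by move=> jh; rewrite ler_wpM2r ?ler_nat ?q_ge// ltW.
(* One cell of length [c] fits at level 0 and, next, two cells of length [c / 2] at level 1. *)
have gamma0 : c <= gamma 0.
  by move: (@gamma_ge 1%N 0%N); rewrite /h expr0 invr1 mulr1 mul1r; exact.
have gamma1 : c <= gamma 1.
  move: (@gamma_ge 2%N 1%N); rewrite /h expr1 (_ : 2 * (c / 2) = c); first exact.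
  by field.
have gammaB i : 1 - h i <= gamma i.
  by rewrite lerBlDr; move: (ltW (q_itv i).2); rewrite -natr1 mulrDl mul1r.
apply: (@le_trans _ _ (196 / 729 * 'C(M + k.+1, k.+1)%:R)).
  apply: ler_wpM2l; first by rewrite divr_ge0 ?ler0n.
  rewrite ler_pdivrMr ?ltr0n ?fact_gt0//.
  by rewrite -natrX -natrM ler_nat exp_le_binomial_fact.
apply: ler_of_geometric_error => // K K3.
apply: le_trans (level_sums_ge c1 c12 (fun i => (q_itv i).1) gammaB gamma0 gamma1
  M k K3) _.
(* This [J] leaves room for the sums [m = M.+1 + e] used with the constant function and for the Haar
   levels [i < M + K], which are shifted by one. *)
have := haar_lower_bound P01 c0 (fun i => (q_itv i).1) (M + K).+1.
rewrite nE -/N; set S := \int[_]_(x in _) _ => bound.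
set T : nat -> nat -> R := fun l m => 16 ^+ k.+2 * (N ^+ 2 *
  ((if l is i.+1 then h i ^+ 3 / 16 else 1 / 4) * ((2 ^- m) ^+ 3 / 16 ^+ k.+1)) *
  Num.max 0 ((if l is i.+1 then q i else 1%N)%:R * 2 ^+ m - N)).
have T_ge0 l m : 0 <= T l m.
  apply: mulr_ge0; first exact: exprn_ge0.
  apply: mulr_ge0; last by rewrite le_max lexx.
  apply: mulr_ge0; first exact: sqr_ge0.
  apply: mulr_ge0; first by case: l => [|i]; apply: divr_ge0 => //; exact/exprn_ge0/ltW.
  by apply: divr_ge0; apply: exprn_ge0 => //; rewrite invr_ge0 exprn_ge0.
have {}bound : \sum_(l < (M + K).+1) \sum_(m < (M + K).+1)
    'C(m + k, k)%:R * T l m <= 16 ^+ k.+2 * S.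
  apply: le_trans (ler_wpM2l _ bound); last by rewrite exprn_ge0.
  rewrite mulr_sumr; apply: ler_sum => l _; rewrite mulr_sumr.
  by apply: ler_sum => m _; rewrite /T mulrCA.
(* Index 0 of the first coordinate, the constant function, is split off; from the other indices only
   the antidiagonals [i + m = M + e] are kept. *)
apply: le_trans bound; rewrite big_ord_recl addrC lerD//.
  apply: le_trans (@sum_shift_le _ (fun m => 'C(m + k, k)%:R * T 0%N m)
    M.+1 K _ _ _); [|by move=> m; rewrite mulr_ge0|by rewrite addSn].
  apply: ler_sum => e _; rewrite ler_wpM2l//.
  set m := (M.+1 + e)%N.
  have -> : 7 / 9 / 2 ^+ e / (2 * c) = N * 2 ^- m.
    rewrite /m addSn exprS exprD /c; field.
    by rewrite !expf_neq0 ?gt_eqF.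
  have -> : T 0%N m = 4 * N ^+ 2 * (2 ^- m) ^+ 3 * Num.max 0 (2 ^+ m - N).
    rewrite /T (_ : 1%:R * 2 ^+ m = 2 ^+ m :> R); last exact: mul1r.
    by rewrite [16 ^+ k.+2]exprS; field; rewrite !expf_neq0.
  have m0 : 2 ^+ m != 0 :> R by rewrite expf_neq0.
  have -> : 4 * (N * 2 ^- m) ^+ 2 * (1 - N * 2 ^- m) =
      4 * N ^+ 2 * (2 ^- m) ^+ 3 * (2 ^+ m - N) by field.
  by rewrite ler_wpM2l ?le_max ?lexx ?orbT// !mulr_ge0 ?exprn_ge0 ?invr_ge0 ?exprn_ge0// ltW.
apply: le_trans (@sum_antidiagonals_le _ (fun i m => 'C(m + k, k)%:R * T i.+1 m)
  _ M K (M + K) (M + K).+1 _ _); [|by move=> i m; rewrite mulr_ge0|by []|exact: leqnSn].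
apply: ler_sum => e _; apply: ler_sum => i _; rewrite ler_wpM2l//.
set m := (M + e - i)%N.
have -> : 7 / 9 / 2 ^+ e = N * (h i * 2 ^- m).
  have im : 2 ^+ i * 2 ^+ m = 2 ^+ M * 2 ^+ e :> R.
    by rewrite -!exprD /m subnKC// -ltnS.
  transitivity (N * c / (2 ^+ i * 2 ^+ m)).
    by rewrite im cN; field; rewrite !expf_neq0.
  by rewrite /h; field; rewrite !expf_neq0.
have -> : T i.+1 m = N ^+ 2 * (h i * 2 ^- m) ^+ 3 *
    Num.max 0 ((q i)%:R * 2 ^+ m - N).
  by rewrite /T [16 ^+ k.+2]exprS; field; rewrite !expf_neq0.
have m0 : 2 ^+ m != 0 :> R by rewrite expf_neq0.
have -> : (N * (h i * 2 ^- m)) ^+ 2 * (gamma i - N * (h i * 2 ^- m)) =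
    N ^+ 2 * (h i * 2 ^- m) ^+ 3 * ((q i)%:R * 2 ^+ m - N).
  by rewrite /gamma; field.
rewrite ler_wpM2l ?le_max ?lexx ?orbT// mulr_ge0 ?sqr_ge0// exprn_ge0//.
by rewrite mulr_ge0 ?invr_ge0 ?exprn_ge0// ltW.
Qed.

Theorem theorem7 (R : realType) (d : nat) (hd : (2 <= d)%N)
    (N : nat) (hN : (0 < N)%N) (P : {fset d.-tuple R})
    (hP : forall z : d.-tuple R, z \in P -> unit_cube z)
    (cardP : #|` P|%fset = N) :
  discrepancy_const R d * (ln N%:R) `^ ((d - 1)%:R / 2) <= L2_discrepancy P.
Proof.
case: d hd P hP cardP => [|[|k]]// _ P hP cardP.
have [|M NM] := discrepancy_sqr_ge hP; first by rewrite cardP.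
rewrite cardP in NM; rewrite /L2_discrepancy; set S := \int[_]_(x in _) _ => bound.
have ln2 : 0 < ln 2 :> R by rewrite ln_gt0// ltr1n.
have lnN : 0 <= ln N%:R :> R by rewrite ln_ge0// ler1n.
have lnNM : ln N%:R <= M.+1%:R * ln 2 :> R.
  rewrite mulr_natl -lnXn// ler_ln ?posrE ?ltr0n ?exprn_gt0//.
  by rewrite -natrX ler_nat.
have powR_half (a : R) : 0 <= a -> (a `^ ((k.+2 - 1)%:R / 2)) ^+ 2 = a ^+ k.+1.
  move=> a0; rewrite -powR_mulrn ?powR_ge0// -powRrM divfK//.
  by rewrite subn1 powR_mulrn.
set L := _ * _; have L0 : 0 <= L.
  rewrite /L /discrepancy_const mulr_ge0 ?powR_ge0// divr_ge0//.
  by rewrite !mulr_ge0 ?exprn_ge0 ?sqrtr_ge0 ?powR_ge0.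
rewrite -(ger0_norm L0) -sqrtr_sqr; apply: ler_wsqrtr.
(* Here [196 / 729 = (14 / 27) ^+ 2], and [14 / 4 ^ d = 7 / 2 ^ (2 * d - 1)] with [d = k.+2]. *)
have -> : L ^+ 2 = 196 / 729 * ((ln N%:R / ln 2) ^+ k.+1 / (k.+1)`!%:R) / 16 ^+ k.+2.
  rewrite /L /discrepancy_const exprMn expr_div_n !exprMn (powR_half _ lnN) (powR_half _ (ltW ln2)).
  rewrite sqr_sqrtr ?ler0n//.
  have -> : (k.+2 - 1 = k.+1)%N by lia.
  have -> : (2 * k.+2 - 1 = (2 * k.+1).+1)%N by lia.
  have -> : (2 ^+ (2 * k.+1).+1) ^+ 2 = 4 * 16 ^+ k.+1 :> R.
    rewrite [2 ^+ _.+1]exprS exprMn -exprM (_ : 2 * k.+1 * 2 = 4 * k.+1)%N ?exprM; last by lia.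
    by congr (_ * _ ^+ _); ring.
  rewrite exprVn [16 ^+ k.+2]exprS.
  by field; rewrite !expf_neq0 ?gt_eqF// ?ltr0n ?fact_gt0.
rewrite ler_pdivrMr ?exprn_gt0// [S * _]mulrC; apply: le_trans bound.
apply: ler_wpM2l; first by rewrite divr_ge0 ?ler0n.
rewrite ler_wpM2r ?invr_ge0 ?ler0n// lerXn2r ?nnegrE ?divr_ge0//.
  exact: ltW.
by rewrite ler_pdivrMr.
Qed.
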